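(* Let $\tau,L\ge1$ be the constants, depending only on $c_{\min}$, of the large scale Lipschitz estimate (see context). There exist constants $C_1=C_1(\|Dc\|_\infty,c_{\min})\ge1$ and $C_2=C_2(c_{\min})\ge1$ such that the following holds. Let $c\in\Omega$, let $S^1,S^2\subset\mathbb{R}^2$ be closed sets, and for $i=1,2$ let $m^i$ be the solution of the arrival time problem \[-\mathrm{tr}\Big[\big(I-\tfrac{Dm\otimes Dm}{|Dm|^2}\big)D^2m\Big]+c(x)|Dm|=1\ \text{ in }\mathbb{R}^2\setminus S^i,\] with $m^i=0$ in $S^i$. Suppose that both $m^i$ satisfy \[|m^i(x)-m^i(y)|\le\tau+L|x-y|\quad\text{for all }x,y\in\mathbb{R}^2\setminus S^i,\] and that there is $R\ge1$ such that the ordering $S^2\subset S^1$ holds on $B_R(0)$. If $s\ge1$, $n$ is a positive integer with $n\le s$, and $R\ge\bar R_n(s):=n\,e^{C_1(\tau+L\frac{s}{n})}$, then \[\{m^2(x)\le s-C_2n\}\subset\{m^1(x)\le s\}\quad\text{on }B_{R-\bar R_n(s)}(0).\]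
   Context: Fix constants $0<c_{\min}\le c_{\max}<\infty$ and $L_0<\infty$; $\Omega$ is the set of functions $c:\mathbb{R}^2\to(0,\infty)$ with $c_{\min}\le c\le c_{\max}$ and $\|Dc\|_\infty\le L_0$. Solutions are understood in the viscosity sense; the arrival time (solution of the arrival time problem) is the maximal subsolution of the stated problem with zero data on $S^i$. ''$A\subset B$ on $B_R(0)$'' means $A\cap B_R(0)\subset B\cap B_R(0)$. The large scale Lipschitz estimate with constants $\tau,L$ depending only on $c_{\min}$ is the bound $|m(x,S)-m(y,S)|\le\tau+L|x-y|$, $x,y\in\mathbb{R}^2\setminus S$, known to hold for the arrival time $m(\cdot,S)$ from every closed $S$ with smooth boundary having interior tangent balls of radius $R_0$ and exterior tangent balls of radius $1$ at each boundary point, where $R_0=\max\{C/c_{\min},2\}$ for a fixed sufficiently large numerical constant $C$. The sets $S^i$ in the claim are not assumed to have this regularity; only the bound itself is assumed for $m^i$.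
   Formalization: C_1 may depend on the upper bound c_max as well as on the bound L_0 for ‖Dc‖_∞ and on c_min; with C_1 independent of c_max the claim fails, e.g. for a large constant c=K, with S^2 a ball just outside B_R(0) and S^1 a very distant ball. *)

(* Defs.v *)
From HB Require Import structures.
From mathcomp Require Import all_boot all_order all_algebra.
From mathcomp Require Import all_classical all_reals all_analysis.
Set Implicit Arguments.
Unset Strict Implicit.
Unset Printing Implicit Defensive.
Import Order.TTheory GRing.Theory Num.Theory numFieldNormedType.Exports.
Local Open Scope classical_set_scope.
Local Open Scope ring_scope.

(* Points of the plane are row vectors.  The library norm `|x| on 'rV[R]_2 is
   the sup norm, so the Euclidean norm is introduced separately; both induce
   the same topology. *)
Definition enorm (R : realType) (x : 'rV[R]_2) : R :=
  Num.sqrt (\sum_i x 0 i ^+ 2).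

Definition eball (R : realType) (z : 'rV[R]_2) (r : R) : set 'rV[R]_2 :=
  [set x | enorm (x - z) < r].

Definition subset_on (R : realType) (D A B : set 'rV[R]_2) : Prop :=
  A `&` D `<=` B `&` D.

Definition partial (R : realType) (i : 'I_2) (f : 'rV[R]_2 -> R) :
    'rV[R]_2 -> R :=
  fun x => 'D_(delta_mx 0 i : 'rV[R]_2) f x.

Definition grad (R : realType) (f : 'rV[R]_2 -> R) (x : 'rV[R]_2) :
    'rV[R]_2 :=
  \row_i partial i f x.

Definition hess (R : realType) (f : 'rV[R]_2 -> R) (x : 'rV[R]_2) :
    'M[R]_2 :=
  \matrix_(i, j) partial i (partial j f) x.

Fixpoint class_C (R : realType) (k : nat) (f : 'rV[R]_2 -> R) : Prop :=
  match k with
  | 0%N => continuous f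
  | k'.+1 => (forall x, differentiable f x) /\
             (forall i, class_C k' (partial i f))
  end.

Definition smooth (R : realType) (f : 'rV[R]_2 -> R) : Prop :=
  forall k, class_C k f.

(* The class Omega.  For a function on the plane, ||Dc||_oo <= L0 means that c
   is Lipschitz with constant L0 for the Euclidean norm. *)
Definition Omega (R : realType) (cmin cmax L0 : R) : set ('rV[R]_2 -> R) :=
  [set c | (forall x, cmin <= c x <= cmax) /\
           (forall x y, `|c x - c y| <= L0 * enorm (x - y))].

(* I - p (x) p / |p|^2; p is a row vector, so p (x) p is p^T *m p. *)
Definition perp_proj (R : realType) (p : 'rV[R]_2) : 'M[R]_2 :=
  1%:M - (enorm p ^- 2) *: (p^T *m p).

(* F_*(x, p, X) <= 1, where F_* is the lower semicontinuous envelope of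
     F(x, p, X) = - tr[(I - p (x) p / |p|^2) X] + c(x) |p|,    p <> 0.
   Since c is continuous, F_* = F for p <> 0, while
     F_*(x, 0, X) = min_{|q| = 1} - tr[(I - q (x) q) X]. *)
Definition subsol_ineq (R : realType) (c : 'rV[R]_2 -> R) (x p : 'rV[R]_2)
    (X : 'M[R]_2) : Prop :=
  (p != 0 -> - \tr (perp_proj p *m X) + c x * enorm p <= 1) /\
  (p = 0 -> exists2 q : 'rV[R]_2,
              enorm q = 1 & - \tr (perp_proj q *m X) <= 1).

Definition upper_semicontinuous (R : realType) (u : 'rV[R]_2 -> R) : Prop :=
  lower_semicontinuous (fun x => (- u x)%:E).

Definition viscosity_subsolution (R : realType) (c : 'rV[R]_2 -> R)
    (D : set 'rV[R]_2) (u : 'rV[R]_2 -> R) : Prop :=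
  forall (phi : 'rV[R]_2 -> R) (x0 : 'rV[R]_2),
    class_C 2 phi -> D x0 ->
    (\forall x \near x0, u x - phi x <= u x0 - phi x0) ->
    subsol_ineq c x0 (grad phi x0) (hess phi x0).

(* Upper semicontinuity is required on the whole plane, so that the boundary
   data is attained: limsup u <= 0 at every point of S. *)
Definition arrival_subsolution (R : realType) (c : 'rV[R]_2 -> R)
    (S : set 'rV[R]_2) (u : 'rV[R]_2 -> R) : Prop :=
  [/\ upper_semicontinuous u,
      viscosity_subsolution c (~` S) u &
      forall x, S x -> u x <= 0].

Definition arrival_time (R : realType) (c : 'rV[R]_2 -> R)
    (S : set 'rV[R]_2) (m : 'rV[R]_2 -> R) : Prop :=
  [/\ arrival_subsolution c S m,
      forall x, S x -> m x = 0 &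
      forall u, arrival_subsolution c S u -> forall x, u x <= m x].

Definition lipschitz_bound (R : realType) (tau L : R) (S : set 'rV[R]_2)
    (m : 'rV[R]_2 -> R) : Prop :=
  forall x y, ~ S x -> ~ S y -> `|m x - m y| <= tau + L * enorm (x - y).

Definition boundary (R : realType) (S : set 'rV[R]_2) : set 'rV[R]_2 :=
  closure S `\` interior S.

Definition smooth_boundary (R : realType) (S : set 'rV[R]_2) : Prop :=
  forall p, boundary S p ->
    exists phi : 'rV[R]_2 -> R,
      [/\ smooth phi, grad phi p != 0 &
          \forall x \near p, S x <-> phi x <= 0].

Definition interior_balls (R : realType) (r : R) (S : set 'rV[R]_2) : Prop :=
  forall p, boundary S p ->
    exists2 z, enorm (p - z) = r & eball z r `<=` S.

Definition exterior_balls (R : realType) (r : R) (S : set 'rV[R]_2) : Prop :=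
  forall p, boundary S p ->
    exists2 z, enorm (p - z) = r & eball z r `<=` ~` S.

(* tau and L are constants for the large scale Lipschitz estimate at cmin, with
   interior radius R_0 = max (C / cmin) 2; they serve all cmax and L0. *)
Definition large_scale_lipschitz (R : realType) (C cmin tau L : R) : Prop :=
  forall (cmax L0 : R) (c : 'rV[R]_2 -> R) (S : set 'rV[R]_2)
         (m : 'rV[R]_2 -> R),
    Omega cmin cmax L0 c ->
    closed S -> smooth_boundary S ->
    interior_balls (Num.max (C / cmin) 2) S -> exterior_balls 1 S ->
    arrival_time c S m ->
    lipschitz_bound tau L S m.

Definition Rbar (R : realType) (C1 tau L s : R) (n : nat) : R :=
  n%:R * expR (C1 * (tau + L * (s / n%:R))).

(* Main.v *)
(* The function m1 is turned into a subsolution for S2 by a space-time erosion.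
   For T >= 1 let M be a soft minimum of m1 - t1 and T, and let u(x) be the largest
   t >= 0 for which some y satisfies
     M(y) >= (1 + 1/T) t + a + kap |x - x0|^2 + L e^(mu t) |x - y|^4.
   At a contact point, with y = x + z and p the gradient of the penalty in y, the
   exponential yields a gain proportional to mu |z| |p|, which dominates the
   variation c(x) - c(y) times |p|; the term t/T absorbs the errors caused by the
   cut-off kap |x - x0|^2, whose gradient is exponentially small in T on the ball
   of radius e^(C1 T) where u can be positive.  The curvature is transported from
   y to x by a map that rotates the tangent direction of the level set at y onto
   the one at x, so that no theorem on sums is needed.  Since m1 is Lipschitz at
   unit scale, u <= 0 on S2, so m2 >= u by maximality, and the loss at x0 is
   bounded independently of T.  The theorem follows by n steps of length T = s/n. *)
Require Import Defs.
From HB Require Import structures.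
From mathcomp Require Import all_boot all_order all_algebra.
From mathcomp Require Import all_classical all_reals all_analysis.
From mathcomp Require Import ring lra.
Import Order.TTheory GRing.Theory Num.Theory numFieldNormedType.Exports.
Local Open Scope classical_set_scope.
Local Open Scope ring_scope.
Set Implicit Arguments.
Unset Strict Implicit.
Unset Printing Implicit Defensive.

(** * The Euclidean plane in coordinates *)

(** Only subsolutions for [S2] can be compared with [m2], which is known through its maximality. The
    sets are ordered in a ball only, while curvature motion has infinite speed of propagation; hence
    a global competitor with a cut-off. The power four answers the singularity of the operator at
    zero gradient: with [z = y - x], the gradient and the Hessian of [|z|^4] vanish at [z = 0], so
    short displacements require no information on [m1], and its equation is used only for
    [|z| > z0]. Taking [z0] of order [e^(-mu T)] makes that Hessian small; the gradient of the
    cut-off must then be small against [z0^3 / T], which is what makes the radius exponential in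
    [T]. Curvature can be transported because only smooth [phi] test [u]: if [phi x = u x], then for
    every linear [P] and small [k] the bound [M (y + k) <= penalty (x + P k) (y + k) (phi (x + P
    k))] exhibits a smooth function touching [M] from above at [y]. The freedom in [P] decides which
    directions at [x] and [y] are compared. *)

Definition pt (R : realType) (a b : R) : 'rV[R]_2 :=
  \row_i (if i == 0 then a else b).

Lemma pt0E (R : realType) (a b : R) : pt a b 0 0 = a.
Proof. by rewrite mxE. Qed.

Lemma pt1E (R : realType) (a b : R) : pt a b 0 1 = b.
Proof. by rewrite mxE. Qed.

Lemma ord2P (i : 'I_2) : i = 0 \/ i = 1.
Proof. by case: i => [[|[|//]] ?]; [left|right]; apply/val_inj. Qed.

Lemma rV2P (R : realType) (x y : 'rV[R]_2) :
  x 0 0 = y 0 0 -> x 0 1 = y 0 1 -> x = y.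
Proof.
by move=> h0 h1; apply/rowP => i; case: (ord2P i) => ->.
Qed.

Lemma ptE (R : realType) (x : 'rV[R]_2) : x = pt (x 0 0) (x 0 1).
Proof. by apply: rV2P; rewrite ?pt0E ?pt1E. Qed.

Lemma sum2E (V : zmodType) (F : 'I_2 -> V) : \sum_i F i = F 0 + F 1.
Proof.
by rewrite !big_ord_recl big_ord0 addr0; congr (_ + F _); apply/val_inj.
Qed.

Section Enorm.
Variable R : realType.
Implicit Types x y z : 'rV[R]_2.

Lemma enormE x : enorm x = Num.sqrt (x 0 0 ^+ 2 + x 0 1 ^+ 2).
Proof. by rewrite /enorm sum2E. Qed.

Lemma enorm_ge0 x : 0 <= enorm x.
Proof. exact: sqrtr_ge0. Qed.

Lemma enorm_sqr x : enorm x ^+ 2 = x 0 0 ^+ 2 + x 0 1 ^+ 2.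
Proof. by rewrite enormE sqr_sqrtr// addr_ge0// sqr_ge0. Qed.

Lemma enormN x : enorm (- x) = enorm x.
Proof. by rewrite !enormE !mxE !sqrrN. Qed.

Lemma enormBC x y : enorm (x - y) = enorm (y - x).
Proof. by rewrite -enormN opprB. Qed.

Lemma enorm0 : enorm (0 : 'rV[R]_2) = 0.
Proof. by rewrite enormE !mxE expr0n addr0 sqrtr0. Qed.

Lemma enormZ (a : R) x : enorm (a *: x) = `|a| * enorm x.
Proof.
by rewrite !enormE !mxE !exprMn -mulrDr sqrtrM ?sqr_ge0// sqrtr_sqr.
Qed.

Lemma enorm_le x (r : R) : 0 <= r ->
  (enorm x <= r) = (x 0 0 ^+ 2 + x 0 1 ^+ 2 <= r ^+ 2).
Proof.
by move=> r0; rewrite -enorm_sqr ler_pXn2r// nnegrE ?enorm_ge0.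
Qed.

Lemma enorm_coord0 x : `|x 0 0| <= enorm x.
Proof.
rewrite -(@ler_pXn2r _ 2)// ?nnegrE ?enorm_ge0// enorm_sqr real_normK ?num_real//.
by rewrite lerDl sqr_ge0.
Qed.

Lemma enorm_coord1 x : `|x 0 1| <= enorm x.
Proof.
rewrite -(@ler_pXn2r _ 2)// ?nnegrE ?enorm_ge0// enorm_sqr real_normK ?num_real//.
by rewrite lerDr sqr_ge0.
Qed.

Lemma enormD x y : enorm (x + y) <= enorm x + enorm y.
Proof.
rewrite enorm_le ?addr_ge0 ?enorm_ge0// sqrrD !enorm_sqr !mxE.
set a := x 0 0; set b := x 0 1; set c := y 0 0; set d := y 0 1.
suff : a * c + b * d <= enorm x * enorm y by lra.
rewrite !enormE -sqrtrM ?addr_ge0 ?sqr_ge0//.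
apply: le_trans (ler_norm _) _.
rewrite -sqrtr_sqr ler_wsqrtr// -/a -/b -/c -/d.
have := sqr_ge0 (a * d - b * c); lra.
Qed.

Lemma enorm_gt0 x : x != 0 -> 0 < enorm x.
Proof.
move=> x0; rewrite lt0r enorm_ge0 andbT; apply: contra x0 => /eqP e0.
have n0 := enorm_coord0 x; have n1 := enorm_coord1 x.
rewrite e0 !normr_le0 in n0 n1.
by apply/eqP/rV2P; rewrite mxE; apply/eqP.
Qed.

Lemma normr_le_enorm x : `|x| <= enorm x.
Proof.
rewrite [leLHS]/Num.norm /= mx_normrE.
apply/bigmax_leP; split => [|[i j] _]; first exact: enorm_ge0.
rewrite (ord1 i) /=.
by case: (ord2P j) => ->; [apply: enorm_coord0|apply: enorm_coord1].
Qed.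

Lemma coord_le_normr x j : `|x 0 j| <= `|x|.
Proof.
rewrite [leRHS]/Num.norm /= mx_normrE; apply/bigmax_geP; right => /=.
by exists (0, j).
Qed.

Lemma enorm_le_normr x : enorm x <= 2 * `|x|.
Proof.
rewrite enorm_le ?mulr_ge0//.
have h0 := coord_le_normr x 0; have h1 := coord_le_normr x 1.
have n0 := normr_ge0 x.
have -> : x 0 0 ^+ 2 = `|x 0 0| ^+ 2 by rewrite real_normK ?num_real.
have -> : x 0 1 ^+ 2 = `|x 0 1| ^+ 2 by rewrite real_normK ?num_real.
have p0 := normr_ge0 (x 0 0); have p1 := normr_ge0 (x 0 1).
have := ler_pM p0 p0 h0 h0; have := ler_pM p1 p1 h1 h1; nra.
Qed.

Lemma nbhs_enormP x (A : set 'rV[R]_2) :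
  nbhs x A <-> exists2 r : R, 0 < r & forall y, enorm (y - x) < r -> A y.
Proof.
split.
  move=> /nbhs_ballP[r r0 h]; exists r => // y yr; apply: h.
  rewrite -ball_normE /= distrC; exact: le_lt_trans (normr_le_enorm _) yr.
move=> [r r0 h]; apply/nbhs_ballP; exists (r / 2) => /=; first by rewrite divr_gt0.
move=> y; rewrite -ball_normE /= distrC => yr; apply: h.
apply: le_lt_trans (enorm_le_normr _) _; rewrite mulrC.
by rewrite -ltr_pdivlMr.
Qed.

End Enorm.

(** * Quadratic test functions and Taylor's inequality *)

Section Calculus.
Variable R : realType.
Implicit Types x y h : 'rV[R]_2.

Lemma is_derive_coord x h (j : 'I_2) :
  is_derive x h (fun y : 'rV[R]_2 => y 0 j : R) (h 0 j).
Proof.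
have hd := @differentiable_coord R 1 2 x 0 j.
apply: DeriveDef; first exact: diff_derivable.
rewrite /derive; apply/cvg_lim => //; apply: cvg_near_cst.
near=> t; rewrite /= !mxE addrK scalerA mulVf ?scale1r//.
by near: t; exact: nbhs_dnbhs_neq.
Unshelve. all: by end_near. Qed.

Lemma derive_partial (f : 'rV[R]_2 -> R) x h : differentiable f x ->
  'D_h f x = h 0 0 * partial 0 f x + h 0 1 * partial 1 f x.
Proof.
move=> df; rewrite /partial !deriveE//.
have {1}-> : h = h 0 0 *: delta_mx 0 0 + h 0 1 *: delta_mx 0 1.
  by apply: rV2P; rewrite !mxE /= !(mulr1, mulr0, addr0, add0r).
by rewrite linearD !linearZ.
Qed.

Lemma is_derive_line (f : 'rV[R]_2 -> R) x h (t : R) :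
  differentiable f (x + t *: h) ->
  is_derive t 1 (fun s : R => f (x + s *: h)) ('D_h f (x + t *: h)).
Proof.
move=> df; have dd := diff_derivable (v := h) df.
have E : (fun s : R => s^-1 *: (((fun s : R => f (x + s *: h)) \o shift t) (s *: 1)
    - f (x + t *: h))) =
  (fun s : R => s^-1 *: ((f \o shift (x + t *: h)) (s *: h) - f (x + t *: h))).
  apply/funext => s /=; congr (_ *: (f _ - _)).
  by rewrite /shift /= scalerDl addrCA /GRing.scale /= mulr1.
by apply: DeriveDef; rewrite /derivable /derive E.
Qed.

Lemma differentiable_bound (f : 'rV[R]_2 -> R) x : differentiable f x ->
  forall e : R, 0 < e -> exists2 r : R, 0 < r & forall h, enorm h < r ->
  `|f (x + h) - f x - (h 0 0 * partial 0 f x + h 0 1 * partial 1 f x)|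
    <= e * enorm h.
Proof.
move=> df e e0.
have /eqaddoP/(_ e e0) := diff_locally df.
move=> /nbhs_enormP[r r0 hr]; exists r => // h hh.
have := hr h; rewrite subr0 => /(_ hh) /=.
rewrite !fctE /= /shift /= opprD addrA (addrC h) -derive_partial// deriveE//.
by move=> /le_trans; apply; rewrite ler_pM2l// normr_le_enorm.
Qed.

(** The mean value theorem on the segment from [x] to [x + h], combined with first order expansions
    of the two partials at [x]. Both mixed entries are kept, since the quadratic form sees their
    sum. *)
Lemma taylor2 (f : 'rV[R]_2 -> R) x : class_C 2 f ->
  forall e : R, 0 < e -> exists2 r : R, 0 < r & forall h, enorm h < r ->
  f (x + h) <= f x + (h 0 0 * grad f x 0 0 + h 0 1 * grad f x 0 1)
    + (h 0 0 ^+ 2 * hess f x 0 0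
       + h 0 0 * h 0 1 * (hess f x 0 1 + hess f x 1 0)
       + h 0 1 ^+ 2 * hess f x 1 1) / 2
    + e * enorm h ^+ 2.
Proof.
move=> [df /= dp] e e0; rewrite !mxE.
have e2 : 0 < e / 2 by rewrite divr_gt0.
have [r0 r00 h0] := differentiable_bound ((dp 0).1 x) e2.
have [r1 r10 h1] := differentiable_bound ((dp 1).1 x) e2.
exists (Num.min r0 r1) => [|h]; first by rewrite lt_min r00.
rewrite lt_min => /andP[hr0 hr1].
set X := (X in _ <= _ + X / 2 + _); set q := (X in _ <= _ + X + _ / 2 + _).
pose F (t : R) := f (x + t *: h) - t * q - t ^+ 2 * (X / 2).
have dF (t : R) : is_derive t 1 F ('D_h f (x + t *: h) - q - t * X).
  have dl := @is_derive_line f x h t (df _).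
  have dq : is_derive t 1 (fun t : R => t * q) q.
    by apply: is_derive_eq; rewrite /GRing.scale /= ?(mulr0, mulr1, addr0, add0r).
  have dX : is_derive t 1 (fun t : R => t ^+ 2 * (X / 2)) (t * X).
    apply: is_derive_eq; rewrite /GRing.scale /= ; lra.
  rewrite /F; apply: is_derive_eq => //.
have cF : {within `[(0 : R), 1], continuous F}.
  apply: continuous_subspaceT => t.
  by apply/differentiable_continuous/derivable1_diffP; case: (dF t).
have [t t01] := MVT ltr01 (fun t _ => dF t) cF.
rewrite /F subr0 mulr1 !scale1r scale0r !addr0 expr0n expr1n !mul0r !subr0 !mul1r.
rewrite derive_partial//.
move: t01; rewrite in_itv /= => /andP[t0 t1].
have et : enorm (t *: h) = t * enorm h by rewrite enormZ gtr0_norm.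
have en := enorm_ge0 h.
have th : enorm (t *: h) <= enorm h by rewrite et ler_piMl// ltW.
have := h0 _ (le_lt_trans th hr0); have := h1 _ (le_lt_trans th hr1).
rewrite et !mxE.
have := enorm_coord0 h; have := enorm_coord1 h.
rewrite /X /q; set u := enorm h.
move: (h 0 0) (h 0 1) (f (x + h)) (f x) => a b fh fx.
move: (partial 0 f (x + t *: h)) (partial 1 f (x + t *: h)) => w0 w1.
move: (partial 0 f x) (partial 1 f x) (partial 0 (partial 0 f) x)
  (partial 0 (partial 1 f) x) (partial 1 (partial 0 f) x)
  (partial 1 (partial 1 f) x) => p0 p1 p00 p01 p10 p11.
rewrite -/u => b1 a1 n1 n0 E.
set d0 := (X in `|X| <= _) in n0; set d1 := (X in `|X| <= _) in n1.
have tu : e / 2 * (t * u) <= e / 2 * u by rewrite ler_pM2l// ler_piMl// ltW.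
have m0 : a * d0 <= u * (e / 2 * u).
  apply: le_trans (ler_norm _) _; rewrite normrM ler_pM//.
  exact: le_trans n0 tu.
have m1 : b * d1 <= u * (e / 2 * u).
  apply: le_trans (ler_norm _) _; rewrite normrM ler_pM//.
  exact: le_trans n1 tu.
rewrite /d0 /d1 in m0 m1; lra.
Qed.

(** Explicit coefficients make the family stable under [partial], so regularity of every order
    follows by induction. *)
Definition qpoly (c0 c1 c2 c3 c4 c5 : R) y : R :=
  c0 + c1 * y 0 0 + c2 * y 0 1
  + c3 * (y 0 0 * y 0 0) + c4 * (y 0 0 * y 0 1) + c5 * (y 0 1 * y 0 1).

Lemma qpoly_differentiable c0 c1 c2 c3 c4 c5 y :
  differentiable (qpoly c0 c1 c2 c3 c4 c5) y.
Proof.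
have d0 := @differentiable_coord R 1 2 y 0 0.
have d1 := @differentiable_coord R 1 2 y 0 1.
pose f0 := fun y : 'rV[R]_2 => y 0 0 : R; pose f1 := fun y : 'rV[R]_2 => y 0 1 : R.
have -> : qpoly c0 c1 c2 c3 c4 c5 = cst c0 + c1 *: f0 + c2 *: f1
    + c3 *: (f0 * f0) + c4 *: (f0 * f1) + c5 *: (f1 * f1) by [].
by do ?[exact: differentiable_cst | apply: differentiableD
       | apply: differentiableZ | apply: differentiableM].
Qed.

Lemma is_derive_qpoly c0 c1 c2 c3 c4 c5 y h :
  is_derive y h (qpoly c0 c1 c2 c3 c4 c5)
   (h 0 0 * (c1 + 2 * c3 * y 0 0 + c4 * y 0 1)
    + h 0 1 * (c2 + c4 * y 0 0 + 2 * c5 * y 0 1)).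
Proof.
have d0 := is_derive_coord y h 0; have d1 := is_derive_coord y h 1.
rewrite /qpoly; apply: is_derive_eq; rewrite /GRing.scale /=; ring.
Qed.

Lemma partial_qpoly0 c0 c1 c2 c3 c4 c5 :
  partial 0 (qpoly c0 c1 c2 c3 c4 c5) = qpoly c1 (2 * c3) c4 0 0 0.
Proof.
apply/funext => y; rewrite /partial.
have [_ ->] := is_derive_qpoly c0 c1 c2 c3 c4 c5 y (delta_mx 0 0).
by rewrite !mxE /= /qpoly; ring.
Qed.

Lemma partial_qpoly1 c0 c1 c2 c3 c4 c5 :
  partial 1 (qpoly c0 c1 c2 c3 c4 c5) = qpoly c2 c4 (2 * c5) 0 0 0.
Proof.
apply/funext => y; rewrite /partial.
have [_ ->] := is_derive_qpoly c0 c1 c2 c3 c4 c5 y (delta_mx 0 1).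
by rewrite !mxE /= /qpoly; ring.
Qed.

Lemma qpoly_smooth k c0 c1 c2 c3 c4 c5 : class_C k (qpoly c0 c1 c2 c3 c4 c5).
Proof.
elim: k c0 c1 c2 c3 c4 c5 => [|k IH] c0 c1 c2 c3 c4 c5 /=.
  by move=> y; apply: differentiable_continuous; exact: qpoly_differentiable.
split=> [y|i]; first exact: qpoly_differentiable.
by case: (ord2P i) => ->; rewrite ?partial_qpoly0 ?partial_qpoly1.
Qed.

(** In the plane [perp_proj p] projects onto the line orthogonal to [p], so the trace is the Hessian
    form at the rotated gradient, divided by [|p|^2]; multiplication by [|p|^2] clears the
    denominator. *)
Lemma subsol_ineqE (c : 'rV[R]_2 -> R) x p (X : 'M[R]_2) : p != 0 ->
  subsol_ineq c x p X <->
  - (X 0 0 * p 0 1 ^+ 2 - (X 0 1 + X 1 0) * (p 0 0 * p 0 1)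
     + X 1 1 * p 0 0 ^+ 2) + c x * enorm p ^+ 3 <= enorm p ^+ 2.
Proof.
move=> p0; have e0 := enorm_gt0 p0.
have -> : subsol_ineq c x p X <-> - \tr (perp_proj p *m X) + c x * enorm p <= 1.
  split=> [[/(_ p0)]//|h]; split=> // /eqP; by rewrite (negbTE p0).
have -> : \tr (perp_proj p *m X) =
   (X 0 0 * p 0 1 ^+ 2 - (X 0 1 + X 1 0) * (p 0 0 * p 0 1)
     + X 1 1 * p 0 0 ^+ 2) / enorm p ^+ 2.
  rewrite /mxtrace sum2E !mxE !sum2E !mxE !big_ord1 !mxE /= enorm_sqr.
  field; rewrite -enorm_sqr; exact/lt0r_neq0/exprn_gt0.
rewrite -(ler_pM2r (exprn_gt0 2 e0)) mulrDl mulNr divfK ?mul1r ?expf_neq0 ?gt_eqF//.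
by rewrite -mulrA -exprS.
Qed.

Lemma subsol_quadratic (c v : 'rV[R]_2 -> R) (D : set 'rV[R]_2) y0 (r : R)
    (p1 p2 a b d : R) :
  viscosity_subsolution c D v -> D y0 -> 0 < r -> pt p1 p2 != 0 ->
  (forall k1 k2, enorm (pt k1 k2) < r -> v (y0 + pt k1 k2) <=
     v y0 + (p1 * k1 + p2 * k2) + (a * k1 ^+ 2 + b * (k1 * k2) + d * k2 ^+ 2)) ->
  - (2 * (a * p2 ^+ 2 - b * (p1 * p2) + d * p1 ^+ 2))
    + c y0 * enorm (pt p1 p2) ^+ 3 <= enorm (pt p1 p2) ^+ 2.
Proof.
move=> sv Dy r0 p0 touch.
pose y1 := y0 0 0; pose y2 := y0 0 1.
pose phi := qpoly (- (p1 * y1 + p2 * y2)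
    + (a * y1 ^+ 2 + b * (y1 * y2) + d * y2 ^+ 2))
  (p1 - (2 * a * y1 + b * y2)) (p2 - (b * y1 + 2 * d * y2)) a b d.
have gE : grad phi y0 = pt p1 p2.
  apply: rV2P; rewrite ?pt0E ?pt1E mxE ?partial_qpoly0 ?partial_qpoly1 /qpoly;
  rewrite -/y1 -/y2; ring.
have near0 : \forall x \near y0, v x - phi x <= v y0 - phi y0.
  apply/nbhs_enormP; exists r => // x xr.
  have := touch ((x - y0) 0 0) ((x - y0) 0 1).
  rewrite -ptE => /(_ xr); rewrite addrC subrK !mxE /phi /qpoly -/y1 -/y2; lra.
have := sv phi y0 (@qpoly_smooth 2 _ _ _ _ _ _) Dy near0.
rewrite gE => /(subsol_ineqE _ _ _ p0).
rewrite !mxE !(partial_qpoly0, partial_qpoly1) /qpoly !mul0r !addr0 /=; lra.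
Qed.

End Calculus.

(** * Expansions up to second order *)

Section Order.
Variable R : realType.
Implicit Types (f g : 'rV[R]_2 -> R) (k : 'rV[R]_2).

(** The bound [O(|k|^n)] at the origin. Calculating with orders replaces differentiating the penalty
    along moving points. *)
Definition vanishes (n : nat) f : Prop :=
  exists C : R, forall k, enorm k <= 1 -> `|f k| <= C * enorm k ^+ n.

Lemma vanishes_cst (a : R) : vanishes 0 (fun=> a).
Proof. by exists `|a| => k _; rewrite expr0 mulr1. Qed.

Lemma vanishes_coord (j : 'I_2) : vanishes 1 (fun k => k 0 j).
Proof.
exists 1 => k _; rewrite expr1 mul1r; case: (ord2P j) => ->.
  exact: enorm_coord0.
exact: enorm_coord1.
Qed.

Lemma vanishesD n f g : vanishes n f -> vanishes n g ->
  vanishes n (fun k => f k + g k).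
Proof.
move=> [C hC] [D hD]; exists (C + D) => k k1.
by rewrite mulrDl (le_trans (ler_normD _ _))// lerD ?hC ?hD.
Qed.

Lemma vanishesM n m f g : vanishes n f -> vanishes m g ->
  vanishes (n + m) (fun k => f k * g k).
Proof.
move=> [C hC] [D hD]; exists (C * D) => k k1.
by rewrite normrM exprD mulrACA ler_pM// ?hC ?hD.
Qed.

Lemma vanishesZ n (a : R) f : vanishes n f -> vanishes n (fun k => a * f k).
Proof. by move=> h; have := vanishesM (vanishes_cst a) h. Qed.

Lemma vanishes_sqr n f : vanishes n f -> vanishes (n + n) (fun k => f k ^+ 2).
Proof.
move=> h; have [C hC] := vanishesM h h; exists C => k k1; rewrite expr2.
exact: hC.
Qed.

Lemma vanishesW n m f : (m <= n)%N -> vanishes n f -> vanishes m f.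
Proof.
move=> mn [C hC]; exists `|C| => k k1; apply: le_trans (hC k k1) _.
apply: le_trans (ler_wpM2r (exprn_ge0 _ (enorm_ge0 _)) (ler_norm C)) _.
by apply: ler_wpM2l => //; apply: ler_wiXn2l => //; exact: enorm_ge0.
Qed.

Lemma vanishes_small n f (e : R) : vanishes n.+1 f -> 0 < e ->
  exists2 r : R, 0 < r & forall k, enorm k < r -> `|f k| <= e * enorm k ^+ n.
Proof.
move=> [C hC] e0; exists (Num.min 1 (e / (`|C| + 1))) => [|k].
  by rewrite lt_min ltr01 divr_gt0// ltr_wpDl.
rewrite lt_min => /andP[k1 ke]; apply: le_trans (hC k (ltW k1)) _.
rewrite exprS mulrA ler_wpM2r ?exprn_ge0 ?enorm_ge0//.
move: ke; rewrite ltr_pdivlMr ?ltr_wpDl// => ke.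
have := enorm_ge0 k; have := ler_norm C; nra.
Qed.

End Order.

(** From [e^x (1 - x) <= 1] and [(1 + x + 2 x^2) (1 - x) = 1 + x^2 (1 - 2 x)]. *)
Lemma expR_le_quadratic (R : realType) (x : R) :
  x <= 1 / 2 -> expR x <= 1 + x + 2 * x ^+ 2.
Proof.
move=> x2; have e0 := expR_gt0 x.
have h : expR x * (1 - x) <= 1.
  rewrite -[leRHS](expRxMexpNx_1 x) ler_pM2l//; exact: expR_ge1Dx.
have x1 : 0 < 1 - x by lra.
rewrite -(ler_pM2r x1); apply: le_trans h _.
have : 0 <= x ^+ 2 * (1 - 2 * x) by rewrite mulr_ge0 ?sqr_ge0//; lra.
lra.
Qed.

(* The factor 2 in front of [u1 ^+ 2] is not sharp; those terms are irrelevant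
   in the direction tangent to the level set. *)
Lemma expR_sqr_expansion (R : realType) (mu Z : R) (u1 u2 w1 w2 : 'rV[R]_2 -> R) :
  vanishes 1 u1 -> vanishes 2 u2 -> vanishes 1 w1 -> vanishes 2 w2 ->
  exists2 f, vanishes 3 f &
  exists2 r : R, 0 < r & forall k, enorm k < r ->
    expR (mu * (u1 k + u2 k)) * (Z + w1 k + w2 k) ^+ 2 <=
    Z ^+ 2 + (mu * Z ^+ 2 * u1 k + 2 * Z * w1 k)
    + (mu * Z ^+ 2 * u2 k + 2 * mu ^+ 2 * Z ^+ 2 * u1 k ^+ 2 + w1 k ^+ 2
       + 2 * Z * w2 k + 2 * mu * Z * (u1 k * w1 k))
    + f k.
Proof.
move=> U1 U2 W1 W2.
(* The exponential is at most [1 + s + 2 s^2 = 1 + mu * u1 + s2 + s3], and the square is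
   [Z^2 + 2 Z w1 + v2 + v3], the digits giving the orders; the witness for [f] collects all products
   of order at least three. *)
pose s k := mu * (u1 k + u2 k).
pose s2 k := mu * u2 k + 2 * mu ^+ 2 * u1 k ^+ 2.
pose s3 k := 2 * mu ^+ 2 * (2 * (u1 k * u2 k) + u2 k * u2 k).
pose v2 k := w1 k ^+ 2 + 2 * Z * w2 k.
pose v3 k := 2 * (w1 k * w2 k) + w2 k * w2 k.
have S : vanishes 1 s by apply: vanishesZ; apply: vanishesD => //; exact: vanishesW U2.
have S2 : vanishes 2 s2.
  by apply: vanishesD; apply: vanishesZ => //; exact: (vanishes_sqr U1).
have S3 : vanishes 3 s3.
  apply: vanishesZ; apply: vanishesD.
    by apply: vanishesZ; exact: (vanishesM U1 U2).
  exact: (@vanishesW _ 4) (vanishesM U2 U2).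
have V2 : vanishes 2 v2.
  by apply: vanishesD; [exact: (vanishes_sqr W1)|exact: vanishesZ].
have V3 : vanishes 3 v3.
  apply: vanishesD.
    by apply: vanishesZ; exact: (vanishesM W1 W2).
  exact: (@vanishesW _ 4) (vanishesM W2 W2).
exists (fun k => mu * (u1 k * v3 k) + 2 * Z * (s2 k * w1 k)
   + s2 k * v2 k + s2 k * v3 k + Z ^+ 2 * s3 k + 2 * Z * (s3 k * w1 k)
   + s3 k * v2 k + s3 k * v3 k + mu * (u1 k * v2 k) + 1 * v3 k).
  do ?[apply: vanishesD].
  - by apply: vanishesZ; exact: (@vanishesW _ 4) (vanishesM U1 V3).
  - by apply: vanishesZ; exact: (vanishesM S2 W1).
  - exact: (@vanishesW _ 4) (vanishesM S2 V2).
  - exact: (@vanishesW _ 5) (vanishesM S2 V3).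
  - exact: vanishesZ.
  - by apply: vanishesZ; exact: (@vanishesW _ 4) (vanishesM S3 W1).
  - exact: (@vanishesW _ 5) (vanishesM S3 V2).
  - exact: (@vanishesW _ 6) (vanishesM S3 V3).
  - by apply: vanishesZ; exact: (vanishesM U1 V2).
  - exact: vanishesZ.
have h2 : 0 < 1 / 2 :> R by rewrite divr_gt0.
have [r r0 hr] := vanishes_small S h2.
exists r => // k /hr; rewrite expr0 mulr1 => /(le_trans (ler_norm _)).
move=> /expR_le_quadratic sk.
apply: le_trans (ler_wpM2r (sqr_ge0 _) sk) _.
by rewrite le_eqVlt; apply/orP; left; apply/eqP; rewrite /s /s2 /s3 /v2 /v3; ring.
Qed.

(** Necessary conditions for a minimum at [s = 0]: for small [s] of sign opposite to [al] the linear
    term would dominate, and once it is gone a negative [be] would dominate the cubic remainder. *)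
Lemma cubic_sign (R : realType) (al be C r : R) : 0 < r ->
  (forall s, `|s| < r -> 0 <= al * s + be * s ^+ 2 + C * `|s| ^+ 3) ->
  al = 0 /\ 0 <= be.
Proof.
move=> r0 h.
have al0 : al = 0.
  apply/eqP; rewrite -normr_le0 leNgt; apply/negP => a0.
  pose K := `|be| + `|C| + 1.
  have K0 : 0 < K by rewrite /K ltr_wpDl// addr_ge0.
  pose s := Num.min (r / 2) (Num.min 1 (`|al| / (2 * K))).
  have s0 : 0 < s by rewrite !lt_min !divr_gt0// ?mulr_gt0//= ltr01.
  have s1 : s <= 1 by rewrite /s !ge_min lexx !orbT.
  have sr : s < r by apply: le_lt_trans (_ : r / 2 < r); [rewrite ge_min lexx|lra].
  have sK : s * (2 * K) <= `|al|.
    by rewrite -ler_pdivlMr ?mulr_gt0// /s !ge_min lexx !orbT.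
  have := h (- Num.sg al * s).
  have aln : al != 0 by rewrite -normr_gt0.
  have sg1 : `|Num.sg al| = 1 by rewrite normr_sg aln.
  rewrite normrM normrN sg1 mul1r (gtr0_norm s0) sr => /(_ isT).
  rewrite mulrA mulrN [al * _]mulrC -normrEsg exprMn sqrrN sqr_sg aln mul1r.
  have b1 := ler_norm be; have c1 := ler_norm C.
  have : be * s ^+ 2 <= `|be| * s ^+ 2 by rewrite ler_wpM2r// sqr_ge0.
  have : C * s ^+ 3 <= `|C| * s ^+ 2.
    apply: le_trans (ler_wpM2r (exprn_ge0 3 (ltW s0)) c1) _.
    by rewrite ler_wpM2l// exprS ler_piMl// sqr_ge0.
  have : s * (s * (2 * K)) <= s * `|al| by rewrite ler_pM2l.
  have : 0 < s ^+ 2 by rewrite exprn_gt0.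
  have : 0 < s * `|al| by rewrite mulr_gt0.
  rewrite /K; move: (`|al|) (`|be|) (`|C|) => A B D; lra.
split=> //; rewrite leNgt; apply/negP => b0.
pose K := `|C| + 1; have K0 : 0 < K by rewrite ltr_wpDl.
pose s := Num.min (r / 2) (- be / (2 * K)).
have s0 : 0 < s by rewrite lt_min !divr_gt0 ?mulr_gt0 ?oppr_gt0.
have sr : s < r by apply: le_lt_trans (_ : r / 2 < r); [rewrite ge_min lexx|lra].
have sK : s * (2 * K) <= - be.
  by rewrite -ler_pdivlMr ?mulr_gt0// /s ge_min lexx orbT.
have := h s; rewrite (gtr0_norm s0) => /(_ sr); rewrite al0 mul0r add0r.
have c1 := ler_norm C.
have := ler_wpM2r (exprn_ge0 3 (ltW s0)) c1.
have := ler_wpM2r (sqr_ge0 s) sK.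
have := exprn_gt0 3 s0; rewrite /K; have : 0 < s ^+ 2 * - be.
  by rewrite mulr_gt0 ?exprn_gt0 ?oppr_gt0.
lra.
Qed.

Lemma affine_ge0 (R : realType) (al be : R) :
  (forall e, 0 < e -> 0 <= al + e * be) -> 0 <= al.
Proof.
move=> h; rewrite leNgt; apply/negP => a0.
have K0 : 0 < 2 * (`|be| + 1) by rewrite mulr_gt0// ltr_wpDl.
have e0 : 0 < - al / (2 * (`|be| + 1)) by rewrite divr_gt0 ?oppr_gt0.
have := h _ e0; have : - al / (2 * (`|be| + 1)) * (2 * (`|be| + 1)) = - al.
  by rewrite divfK// gt_eqF.
move: e0; set e := _ / _ => e0 eE hh.
have := ler_wpM2l (ltW e0) (ler_norm be); lra.
Qed.

(** * The penalty *)

Section Penalty.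
Variable R : realType.
Implicit Types x y z h k : 'rV[R]_2.

Definition dot x y : R := x 0 0 * y 0 0 + x 0 1 * y 0 1.

Definition qform (A B C : R) h : R :=
  A * h 0 0 ^+ 2 + B * (h 0 0 * h 0 1) + C * h 0 1 ^+ 2.

(* As a function of [t] this is increasing, with a derivative that grows with
   the distance between [x] and [y]. *)
Definition penalty (a del kap L mu : R) x0 x y (t : R) : R :=
  (1 + del) * t + a + kap * enorm (x - x0) ^+ 2
  + L * (expR (mu * t) * (enorm (y - x) ^+ 2) ^+ 2).

(** The derivative of [penalty] in [t], with [z = y - x]. *)
Definition speed (del L mu : R) z (t : R) : R :=
  1 + del + mu * (L * expR (mu * t) * (enorm z ^+ 2) ^+ 2).

Lemma vanishes_dot x (f : 'rV[R]_2 -> 'rV[R]_2) :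
  (forall j, vanishes 1 (fun k => f k 0 j)) -> vanishes 1 (fun k => dot x (f k)).
Proof. by move=> hf; apply: vanishesD; apply: vanishesZ; exact: hf. Qed.

Lemma vanishes_qform A B C (f : 'rV[R]_2 -> 'rV[R]_2) :
  (forall j, vanishes 1 (fun k => f k 0 j)) ->
  vanishes 2 (fun k => qform A B C (f k)).
Proof.
move=> hf; apply: vanishesD; first apply: vanishesD; apply: vanishesZ.
- exact: (vanishes_sqr (hf 0)).
- exact: (vanishesM (hf 0) (hf 1)).
- exact: (vanishes_sqr (hf 1)).
Qed.

Lemma vanishes_enorm_sqr (f : 'rV[R]_2 -> 'rV[R]_2) :
  (forall j, vanishes 1 (fun k => f k 0 j)) ->
  vanishes 2 (fun k => enorm (f k) ^+ 2).
Proof.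
move=> hf; have [K hK] := vanishesD (vanishes_sqr (hf 0)) (vanishes_sqr (hf 1)).
by exists K => k /hK; rewrite enorm_sqr.
Qed.

(** [P] displaces [x] and [N] displaces the difference [y - x], the only thing the quartic term sees
    besides [t]. That term is handled by [expR_sqr_expansion] with [Z = |z|^2]; the others expand
    exactly. *)
Lemma penalty_expansion a del kap L mu x0 x y t q (A B C : R)
    (P N : 'rV[R]_2 -> 'rV[R]_2) : 0 <= L ->
  (forall j, vanishes 1 (fun k => P k 0 j)) ->
  (forall j, vanishes 1 (fun k => N k 0 j)) ->
  let z := y - x in let LE := L * expR (mu * t) in
  exists2 f, vanishes 3 f &
  exists2 r : R, 0 < r & forall k, enorm k < r ->
    penalty a del kap L mu x0 (x + P k) (y + (P k + N k))
      (t + (dot q (P k) + qform A B C (P k))) <=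
    penalty a del kap L mu x0 x y t
    + (speed del L mu z t * dot q (P k) + 2 * kap * dot (x - x0) (P k)
       + 4 * LE * enorm z ^+ 2 * dot z (N k))
    + (speed del L mu z t * qform A B C (P k) + kap * enorm (P k) ^+ 2
       + LE * (2 * enorm z ^+ 2 * enorm (N k) ^+ 2 + 4 * dot z (N k) ^+ 2
               + 2 * mu ^+ 2 * (enorm z ^+ 2) ^+ 2 * dot q (P k) ^+ 2
               + 4 * mu * enorm z ^+ 2 * (dot q (P k) * dot z (N k))))
    + f k.
Proof.
move=> L0 hP hN z LE.
have U1 := vanishes_dot q hP; have U2 := vanishes_qform A B C hP.
have W1 := vanishesZ 2 (vanishes_dot z hN); have W2 := vanishes_enorm_sqr hN.
have [f hf [r r0 hr]] := expR_sqr_expansion mu (enorm z ^+ 2) U1 U2 W1 W2.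
exists (fun k => LE * f k); first exact: vanishesZ.
exists r => // k /hr.
rewrite /penalty /speed (mulrDr mu t) (expRD (mu * t)).
have -> : enorm (x + P k - x0) ^+ 2 =
    enorm (x - x0) ^+ 2 + 2 * dot (x - x0) (P k) + enorm (P k) ^+ 2.
  by rewrite !enorm_sqr /dot !mxE; ring.
have -> : y + (P k + N k) - (x + P k) = z + N k.
  by rewrite /z; apply: rV2P; rewrite !mxE; ring.
have -> : enorm (z + N k) ^+ 2 = enorm z ^+ 2 + 2 * dot z (N k) + enorm (N k) ^+ 2.
  by rewrite !enorm_sqr /dot !mxE; ring.
have LE0 : 0 <= LE by rewrite mulr_ge0// expR_ge0.
move=> /(ler_wpM2l LE0); rewrite /LE -/z.
move: (dot q _) (qform _ _ _ _) (dot z _) (dot (x - x0) _) (enorm (N k))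
  (enorm z) (enorm (P k)) (expR (mu * t)) (expR _) (f k) => *; lra.
Qed.

Lemma vanishes_opp j : vanishes 1 (fun k : 'rV[R]_2 => (- k) 0 j).
Proof.
have [K hK] := vanishes_coord R j; exists K => k /hK.
by rewrite mxE normrN.
Qed.

Lemma vanishes3_scale (f : 'rV[R]_2 -> R) v : vanishes 3 f ->
  exists2 K, 0 <= K & exists2 r : R, 0 < r & forall s, `|s| < r ->
    f (s *: v) <= K * `|s| ^+ 3.
Proof.
move=> [K hK]; exists (`|K| * enorm v ^+ 3).
  by rewrite mulr_ge0 ?exprn_ge0 ?enorm_ge0.
exists (enorm v + 1)^-1 => [|s hs]; first by rewrite invr_gt0 ltr_wpDl ?enorm_ge0.
apply: le_trans (ler_norm _) _; apply: le_trans (hK _ _) _.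
  rewrite enormZ; move: hs; rewrite -[_^-1]mul1r ltr_pdivlMr ?ltr_wpDl ?enorm_ge0//.
  have := normr_ge0 s; have := enorm_ge0 v; lra.
rewrite enormZ exprMn mulrCA mulrC ler_wpM2r ?exprn_ge0//.
by rewrite ler_wpM2r ?ler_norm// exprn_ge0// enorm_ge0.
Qed.

(** Minimality in [x] with [y] fixed, that is [P k = k] and [N k = - k]. Directions with
    [dot q v = 0] remove the terms created by the exponential; the Taylor error [e] is sent to zero
    at the end. *)
Lemma contact_stationary a del kap L mu x0 x y t q (A B C : R) : 0 <= L ->
  let z := y - x in let LE := L * expR (mu * t) in
  (forall e, 0 < e -> exists2 r : R, 0 < r & forall h, enorm h < r ->
    penalty a del kap L mu x0 x y t <=
    penalty a del kap L mu x0 (x + h) y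
      (t + (dot q h + qform (A + e) B (C + e) h))) ->
  (forall v, speed del L mu z t * dot q v =
      4 * LE * enorm z ^+ 2 * dot z v - 2 * kap * dot (x - x0) v) /\
  (forall v, dot q v = 0 -> 0 <= speed del L mu z t * qform A B C v
      + kap * enorm v ^+ 2
      + LE * (2 * enorm z ^+ 2 * enorm v ^+ 2 + 4 * dot z v ^+ 2)).
Proof.
move=> L0 z LE hA.
have key e v : 0 < e ->
    speed del L mu z t * dot q v + 2 * kap * dot (x - x0) v
      - 4 * LE * enorm z ^+ 2 * dot z v = 0 /\
    0 <= speed del L mu z t * qform (A + e) B (C + e) v + kap * enorm v ^+ 2
       + LE * (2 * enorm z ^+ 2 * enorm v ^+ 2 + 4 * dot z v ^+ 2
               + 2 * mu ^+ 2 * (enorm z ^+ 2) ^+ 2 * dot q v ^+ 2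
               - 4 * mu * enorm z ^+ 2 * (dot q v * dot z v)).
  move=> e0; have [r r0 hr] := hA e e0.
  have [f hf [r' r'0 hr']] := penalty_expansion a del kap mu x0 x y t q
    (A + e) B (C + e) L0 (vanishes_coord R) vanishes_opp.
  have [K K0 [r2 r20 hr2]] := vanishes3_scale v hf.
  pose rr := Num.min (Num.min r r') (r2 * (enorm v + 1)) / (enorm v + 1).
  have v1 : 0 < enorm v + 1 by rewrite ltr_wpDl ?enorm_ge0.
  have rr0 : 0 < rr by rewrite divr_gt0// !lt_min r0 r'0 mulr_gt0.
  apply: (@cubic_sign _ _ _ K rr) => // s.
  rewrite ltr_pdivlMr// !lt_min => /andP[/andP[sr sr'] sr2].
  have sv : enorm (s *: v) <= `|s| * (enorm v + 1).
    by rewrite enormZ ler_wpM2l// lerDl.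
  have := hr2 s; rewrite ltr_pM2r// in sr2 => /(_ sr2).
  have := hr' _ (le_lt_trans sv sr'); have := hr _ (le_lt_trans sv sr).
  rewrite subrr addr0 enormN enormZ exprMn real_normK ?num_real// -/z -/LE.
  have -> : dot q (s *: v) = s * dot q v by rewrite /dot !mxE; ring.
  have -> : dot (x - x0) (s *: v) = s * dot (x - x0) v by rewrite /dot !mxE; ring.
  have -> : dot z (- (s *: v)) = - (s * dot z v) by rewrite /dot !mxE; ring.
  have -> : qform (A + e) B (C + e) (s *: v) = s ^+ 2 * qform (A + e) B (C + e) v.
    by rewrite /qform !mxE; ring.
  move: (penalty _ _ _ _ _ _ _ _ _) (penalty _ _ _ _ _ _ _ _ _) => p1 p2.
  move: (speed _ _ _ _ _) (dot q v) (dot z v) (dot (x - x0) v) (qform _ _ _ _)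
    (enorm v) (enorm z) LE (f _) => S dq dz dx Q nv nz E F.
  lra.
split=> [v|v qv].
  by have [/eqP + _] := key 1 v ltr01; rewrite subr_eq0 => /eqP <-; rewrite addrK.
apply: (@affine_ge0 _ _ (speed del L mu z t * enorm v ^+ 2)) => e e0.
have [_] := key e v e0; rewrite qv.
have -> : qform (A + e) B (C + e) v = qform A B C v + e * enorm v ^+ 2.
  by rewrite /qform enorm_sqr; ring.
lra.
Qed.

End Penalty.

(** * Contact points *)

Section Contact.
Variable R : realType.
Implicit Types (x y z h k p w : 'rV[R]_2) (f : 'rV[R]_2 -> R).

Definition perp x : 'rV[R]_2 := pt (- x 0 1) (x 0 0).

Lemma enorm_perp x : enorm (perp x) = enorm x.
Proof. by rewrite !enormE pt0E pt1E sqrrN addrC. Qed.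

Lemma dot_perp x : dot x (perp x) = 0.
Proof. by rewrite /dot pt0E pt1E; ring. Qed.

Lemma perpZ (a : R) x : perp (a *: x) = a *: perp x.
Proof. by apply: rV2P; rewrite /perp !mxE /=; ring. Qed.

Lemma qformZ (a : R) A B C x : qform A B C (a *: x) = a ^+ 2 * qform A B C x.
Proof. by rewrite /qform !mxE; ring. Qed.

Lemma dotZl (a : R) x y : dot (a *: x) y = a * dot x y.
Proof. by rewrite /dot !mxE; ring. Qed.

Lemma dotZr (a : R) x y : dot x (a *: y) = a * dot x y.
Proof. by rewrite /dot !mxE; ring. Qed.

Lemma dotBl x y z : dot (x - y) z = dot x z - dot y z.
Proof. by rewrite /dot !mxE; ring. Qed.

Lemma enorm_perpE x : enorm (perp x) ^+ 2 = enorm x ^+ 2.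
Proof. by rewrite enorm_perp. Qed.

Definition is_linform f := exists a, forall k, f k = dot a k.

Definition is_qform f := exists A B C, forall k, f k = qform A B C k.

Lemma is_qformD f g : is_qform f -> is_qform g -> is_qform (fun k => f k + g k).
Proof.
move=> [A [B [C h]]] [A' [B' [C' h']]]; exists (A + A'), (B + B'), (C + C') => k.
by rewrite h h' /qform; ring.
Qed.

Lemma is_qformZ (a : R) f : is_qform f -> is_qform (fun k => a * f k).
Proof.
move=> [A [B [C h]]]; exists (a * A), (a * B), (a * C) => k.
by rewrite h /qform; ring.
Qed.

Lemma is_qformM f g : is_linform f -> is_linform g -> is_qform (fun k => f k * g k).
Proof.
move=> [a h] [b h']; exists (a 0 0 * b 0 0), (a 0 0 * b 0 1 + a 0 1 * b 0 0),
  (a 0 1 * b 0 1) => k.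
by rewrite h h' /qform /dot; ring.
Qed.

Lemma is_qformX2 f : is_linform f -> is_qform (fun k => f k ^+ 2).
Proof.
move=> h; have [A [B [C E]]] := is_qformM h h.
by exists A, B, C => k; rewrite expr2.
Qed.

(** Complex multiplication, the plane being identified with the complex numbers: a rotation with
    dilation. *)
Definition cmul x k : 'rV[R]_2 :=
  pt (x 0 0 * k 0 0 - x 0 1 * k 0 1) (x 0 1 * k 0 0 + x 0 0 * k 0 1).

Lemma is_linform_dot x (f : 'rV[R]_2 -> 'rV[R]_2) :
  (forall j, is_linform (fun k => f k 0 j)) -> is_linform (fun k => dot x (f k)).
Proof.
move=> hf; have [a ha] := hf 0; have [b hb] := hf 1.
exists (x 0 0 *: a + x 0 1 *: b) => k; rewrite {1}/dot ha hb /dot !mxE; ring.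
Qed.

Lemma is_qform_comp A B C (f : 'rV[R]_2 -> 'rV[R]_2) :
  (forall j, is_linform (fun k => f k 0 j)) -> is_qform (fun k => qform A B C (f k)).
Proof.
move=> hf; apply: is_qformD; first apply: is_qformD; apply: is_qformZ.
- exact: is_qformX2.
- exact: is_qformM.
- exact: is_qformX2.
Qed.

Lemma is_qform_enorm (f : 'rV[R]_2 -> 'rV[R]_2) :
  (forall j, is_linform (fun k => f k 0 j)) -> is_qform (fun k => enorm (f k) ^+ 2).
Proof.
move=> hf; have [A [B [C E]]] := is_qform_comp 1 0 1 hf.
by exists A, B, C => k; rewrite -E enorm_sqr /qform; ring.
Qed.

Lemma is_linform_vanishes f : is_linform f -> vanishes 1 f.
Proof.
move=> [a ha].
have [K hK] := vanishes_dot a (vanishes_coord R).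
by exists K => k; rewrite ha; exact: hK.
Qed.

Lemma is_qform_vanishes f : is_qform f -> vanishes 2 f.
Proof.
move=> [A [B [C hf]]].
have [K hK] := vanishes_qform A B C (vanishes_coord R).
by exists K => k; rewrite hf; exact: hK.
Qed.

Lemma is_linform_cmul x j : is_linform (fun k => cmul x k 0 j).
Proof.
case: (ord2P j) => ->.
  by exists (pt (x 0 0) (- x 0 1)) => k; rewrite /dot !pt0E !pt1E; ring.
by exists (pt (x 0 1) (x 0 0)) => k; rewrite /dot !pt0E !pt1E; ring.
Qed.

Lemma is_linform_sub_cmul x j : is_linform (fun k => (k - cmul x k) 0 j).
Proof.
case: (ord2P j) => ->.
  by exists (pt (1 - x 0 0) (x 0 1)) => k; rewrite /dot !mxE /=; ring.
by exists (pt (- x 0 1) (1 - x 0 0)) => k; rewrite /dot !mxE /=; ring.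
Qed.

(** The cubic remainder is dominated by [e |k|^2], which turns the bound into a quadratic test
    function; then [e] tends to zero. *)
Lemma subsol_expansion (c v : 'rV[R]_2 -> R) (D : set 'rV[R]_2) y p (B f : 'rV[R]_2 -> R) (r : R) :
  viscosity_subsolution c D v -> D y -> p != 0 -> is_qform B -> vanishes 3 f ->
  0 < r ->
  (forall k, enorm k < r -> v (y + k) <= v y + dot p k + B k + f k) ->
  - (2 * B (perp p)) + c y * enorm p ^+ 3 <= enorm p ^+ 2.
Proof.
move=> sv Dy p0 [A [B' [C hB]]] hf r0 touch.
rewrite -subr_ge0; apply: (@affine_ge0 _ _ (2 * enorm p ^+ 2)) => e e0.
have [r' r'0 hr'] := vanishes_small hf e0.
have pE : pt (p 0 0) (p 0 1) != 0 by rewrite -ptE.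
have rr0 : 0 < Num.min r r' by rewrite lt_min r0.
have := @subsol_quadratic _ _ _ _ _ _ _ _ (A + e) B' (C + e) sv Dy rr0 pE.
rewrite -ptE => /(_ _)/wrap[].
  move=> k1 k2; rewrite lt_min => /andP[kr kr'].
  apply: le_trans (touch _ kr) _.
  have := le_trans (ler_norm _) (hr' _ kr'); rewrite enorm_sqr.
  rewrite hB /dot /qform !pt0E !pt1E; lra.
by rewrite hB /qform /perp pt0E pt1E !enorm_sqr; lra.
Qed.

(** The equation for [m] at [y], read with [x] following [y]. The map [P] carries [perp p] to
    [perp w], on which [q] vanishes by stationarity, so only the curvature of the test function and
    errors in [g] survive. *)
Lemma contact_moving a del kap L mu x0 x y t q (A B C : R)
    (c m M : 'rV[R]_2 -> R) (D : set 'rV[R]_2) (ga K r0 : R) : 0 <= L ->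
  let z := y - x in let LE := L * expR (mu * t) in
  let p := (4 * LE * enorm z ^+ 2) *: z in
  let g := (2 * kap) *: (x - x0) in
  viscosity_subsolution c D m -> D y -> p != 0 -> 0 < r0 -> 1 <= ga ->
  (forall y' s, `|s| < r0 -> M y' <= M y + s -> m y' <= m y + ga * s + K * s ^+ 2) ->
  M y = penalty a del kap L mu x0 x y t ->
  (forall e, 0 < e -> exists2 r : R, 0 < r & forall h, enorm h < r -> forall y',
    M y' <= penalty a del kap L mu x0 (x + h) y'
      (t + (dot q h + qform (A + e) B (C + e) h))) ->
  0 < speed del L mu z t -> speed del L mu z t *: q = p - g ->
  c y * enorm p ^+ 3 <= enorm p ^+ 2 +
    2 * (speed del L mu z t * qform A B C (perp (p - g))
      + kap * enorm (p - g) ^+ 2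
      + LE * (2 * enorm z ^+ 2 * enorm g ^+ 2 + 4 * dot z (perp g) ^+ 2)).
Proof.
move=> L0 z LE p g sv Dy p0 r00 ga1 hM My hA Ht0 st.
set w := p - g in st *.
have P0 := enorm_gt0 p0.
have P20 : enorm p ^+ 2 != 0 by rewrite expf_neq0// gt_eqF.
rewrite -subr_ge0.
apply: (@affine_ge0 _ _ (2 * (speed del L mu z t * enorm w ^+ 2))) => e e0.
(* [om] is the complex quotient [w / p], so that multiplication by [om] maps
   the tangent direction [perp p] at [y] to [perp w], the tangent direction
   at [x]. *)
pose om : 'rV[R]_2 := pt (dot w p / enorm p ^+ 2)
  ((w 0 1 * p 0 0 - w 0 0 * p 0 1) / enorm p ^+ 2).
pose P := cmul om; pose N k := k - P k.
have lP j : is_linform (fun k => P k 0 j) by exact: is_linform_cmul.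
have lN j : is_linform (fun k => N k 0 j) by exact: is_linform_sub_cmul.
have Pp : P (perp p) = perp w.
  apply: rV2P; rewrite /P /cmul /perp /om !(pt0E, pt1E) /dot;
  move: P20; rewrite enorm_sqr => P20; field => //.
have Np : N (perp p) = perp g.
  rewrite /N Pp /w; apply: rV2P; rewrite !mxE /=; ring.
have [f hf [r1 r10 hr1]] := penalty_expansion a del kap mu x0 x y t q
  (A + e) B (C + e) L0 (fun j => is_linform_vanishes (lP j))
  (fun j => is_linform_vanishes (lN j)).
have [r2 r20 hr2] := hA e e0.
rewrite -/z -/LE in hr1.
pose Bf k := speed del L mu z t * qform (A + e) B (C + e) (P k)
  + kap * enorm (P k) ^+ 2
  + LE * (2 * enorm z ^+ 2 * enorm (N k) ^+ 2 + 4 * dot z (N k) ^+ 2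
          + 2 * mu ^+ 2 * (enorm z ^+ 2) ^+ 2 * dot q (P k) ^+ 2
          + 4 * mu * enorm z ^+ 2 * (dot q (P k) * dot z (N k))).
have qB : is_qform Bf.
  have lqP := is_linform_dot q lP; have lzN := is_linform_dot z lN.
  apply: is_qformD; first apply: is_qformD.
  - by apply: is_qformZ; exact: is_qform_comp.
  - by apply: is_qformZ; exact: is_qform_enorm.
  - apply: is_qformZ; apply: is_qformD; first apply: is_qformD; first apply: is_qformD.
    + by apply: is_qformZ; exact: is_qform_enorm.
    + by apply: is_qformZ; exact: is_qformX2.
    + by apply: is_qformZ; exact: is_qformX2.
    + by apply: is_qformZ; exact: is_qformM.
(* By stationarity the first two terms add up to [dot p (P k)], and the third is [dot p (N k)]: the
   gradient at [y] is [p] whatever [P] is. *)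
have lin k : speed del L mu z t * dot q (P k) + 2 * kap * dot (x - x0) (P k)
       + 4 * LE * enorm z ^+ 2 * dot z (N k) = dot p k.
  have -> : speed del L mu z t * dot q (P k) = dot (speed del L mu z t *: q) (P k).
    by rewrite /dot !mxE; ring.
  rewrite st /w /p /g /N /dot !mxE; ring.
have lp : is_linform (dot p) by exists p.
pose S k := dot p k + (Bf k + f k).
have vB := is_qform_vanishes qB; have vp := is_linform_vanishes lp.
have vBf : vanishes 2 (fun k => Bf k + f k).
  by apply: vanishesD => //; exact: vanishesW hf.
have vS : vanishes 1 S by apply: vanishesD => //; exact: vanishesW vBf.
have r02 : 0 < r0 / 2 by rewrite divr_gt0.
have [r3 r30 hr3] := vanishes_small vS r02.
have [r4 r40 hr4] : exists2 r4 : R, 0 < r4 & forall k, enorm k < r4 -> enorm (P k) < r2.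
  have [K' hK'] := vanishes_enorm_sqr (fun j => is_linform_vanishes (lP j)).
  have v1 : vanishes 1 (fun k => enorm (P k) ^+ 2) by apply: (@vanishesW _ 2) => //; exists K'.
  have r22 : 0 < r2 ^+ 2 / 2 by rewrite divr_gt0// exprn_gt0.
  have [r4 r40 hr4] := vanishes_small v1 r22.
  exists r4 => // k /hr4; rewrite expr0 mulr1 ger0_norm ?sqr_ge0// => hk.
  rewrite -(@ltr_pXn2r _ 2)// ?nnegrE ?enorm_ge0 ?ltW//.
  apply: le_lt_trans hk _; rewrite ltr_pdivrMr// mulr_natr mulr2n ltrDl exprn_gt0//.
pose ra := Num.min (Num.min r1 r3) r4.
have ra0 : 0 < ra by rewrite !lt_min r10 r30 r40.
(* The cubic part of [ga * S + K * S^2]. The remaining new term [K * (dot p k)^2] is quadratic and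
   vanishes on [perp p]. *)
pose F k := ga * f k + K * (2 * (dot p k * (Bf k + f k))
  + (Bf k + f k) * (Bf k + f k)).
have vF : vanishes 3 F.
  apply: vanishesD; apply: vanishesZ => //; apply: vanishesD.
    by apply: vanishesZ; exact: (vanishesM vp vBf).
  exact: (@vanishesW _ 4) (vanishesM vBf vBf).
have ga0 : 0 < ga by apply: lt_le_trans ga1.
have gp0 : ga *: p != 0 by rewrite scaler_eq0 gt_eqF.
have qGB : is_qform (fun k => ga * Bf k + K * dot p k ^+ 2).
  by apply: is_qformD; apply: is_qformZ => //; exact: is_qformX2.
have := subsol_expansion sv Dy gp0 qGB vF ra0.
move=> /(_ _)/wrap[].
  move=> k; rewrite !lt_min => /andP[/andP[k1 k3] k4].
  have MS : M (y + k) <= M y + S k.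
    have := hr2 _ (hr4 _ k4) (y + k); have := hr1 _ k1.
    have -> : y + (P k + N k) = y + k by rewrite /N [P k + _]addrC subrK.
    rewrite lin -/(Bf k) -My /S => h1 /le_trans; apply.
    by apply: le_trans h1 _; rewrite !addrA.
  have Sr : `|S k| < r0.
    apply: le_lt_trans (hr3 _ k3) _; rewrite expr0 mulr1; lra.
  apply: le_trans (hM _ _ Sr MS) _.
  rewrite dotZl.
  rewrite le_eqVlt; apply/orP; left; apply/eqP; rewrite /S /F; ring.
have -> : dot p (perp (ga *: p)) = 0 by rewrite perpZ dotZr dot_perp mulr0.
have -> : Bf (perp (ga *: p)) = ga ^+ 2 * Bf (perp p).
  by have [A' [B' [C' hB]]] := qB; rewrite !hB perpZ qformZ.
rewrite enormZ gtr0_norm// !exprMn expr0n /= mulr0 addr0.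
have -> : Bf (perp p) = speed del L mu z t * qform A B C (perp w)
    + kap * enorm w ^+ 2
    + LE * (2 * enorm z ^+ 2 * enorm g ^+ 2 + 4 * dot z (perp g) ^+ 2)
    + e * (speed del L mu z t * enorm w ^+ 2).
  have qw : dot q (perp w) = 0.
    by apply: (mulfI (lt0r_neq0 Ht0)); rewrite mulr0 -dotZl st dot_perp.
  have -> : qform A B C (perp w) = qform (A + e) B (C + e) (perp w) - e * enorm w ^+ 2.
    by rewrite -(enorm_perpE w) enorm_sqr /qform; ring.
  rewrite /Bf Pp Np qw !enorm_perpE; ring.
set V := speed del L mu z t * qform A B C (perp w) + _ + _.
set T := e * (_ * _) => h.
have ga2 : 0 < ga ^+ 2 by rewrite exprn_gt0.
have {}h : ga * (c y * enorm p ^+ 3 - 2 * (V + T)) <= enorm p ^+ 2.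
  rewrite -(ler_pM2l ga2); apply: le_trans h; rewrite le_eqVlt; apply/orP; left.
  by apply/eqP; ring.
have -> : e * (2 * (speed del L mu z t * enorm w ^+ 2)) = 2 * T by rewrite /T; ring.
have [W0|W0] := ltP (c y * enorm p ^+ 3 - 2 * (V + T)) 0.
  by have := sqr_ge0 (enorm p); lra.
have := le_trans (ler_peMl W0 ga1) h; lra.
Qed.

End Contact.

(** Here [P], [W], [zz] stand for the lengths of [p], [p - g], [z], and [G] bounds that of [g]. The
    term [lam * (zz * P) * W^2] pays for the variation of [c], the factor 2 in [2 * L0 <= lam]
    compensating [W^2 >= P^2 / 2]; [del] pays for all errors due to [g]. *)
Lemma contact_arith (R : realType) (P W G zz z0 Ht del kap LEZ lam L0 cx cy cmax : R) :
  0 < z0 -> z0 <= 1 -> z0 < zz -> 0 < P -> 0 <= G -> 0 <= W -> 0 < del -> del <= 1 ->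
  0 <= kap -> 0 <= L0 -> 0 <= cx -> cx <= cmax -> cx - cy <= L0 * zz ->
  2 * L0 <= lam -> Ht = 1 + del + lam * (zz * P) -> 4 * LEZ * zz = P ->
  P - G <= W -> W <= P + G -> G <= z0 -> 16 * G <= del * P ->
  8 * kap + 7 * cmax * G <= del / 2 ->
  P ^+ 2 - cy * P ^+ 3 + 2 * kap * W ^+ 2 + 12 * LEZ * G ^+ 2 + cx * W ^+ 3
    <= Ht * W ^+ 2.
Proof.
move=> z00 z01 zz0 P0 G0 W0 d0 d1 k0 L00 cx0 cxm cxy lam0 -> LEZE WP1 WP2 Gz GP kG.
have zz00 : 0 < zz by apply: lt_trans zz0.
have GP16 : 16 * G <= P by apply: le_trans GP _; rewrite ler_piMl// ltW.
have W2P : W <= 2 * P by lra.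
have cm0 : 0 <= cmax by apply: le_trans cxm.
have PW : P ^+ 2 - 2 * (P * G) <= W ^+ 2.
  have : 0 <= (W - (P - G)) * (W + (P - G)) by apply: mulr_ge0; lra.
  by have := sqr_ge0 G; lra.
have PG : P * (16 * G) <= P * (del * P) by rewrite ler_pM2l.
have P2 : 0 < P ^+ 2 by rewrite exprn_gt0.
have P3 : 0 < P ^+ 3 by rewrite exprn_gt0.
have PGP : P * (16 * G) <= P * P by rewrite ler_pM2l.
have Wh : P ^+ 2 / 2 <= W ^+ 2 by lra.
have W4 : W ^+ 2 <= 4 * P ^+ 2.
  by have := ler_pM W0 W0 W2P W2P; lra.
have s1 : L0 * zz * P ^+ 3 <= lam * (zz * P) * W ^+ 2.
  have h1 : 2 * L0 * (zz * P * (P ^+ 2 / 2)) <= lam * (zz * P * W ^+ 2).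
    apply: ler_pM => //; first by rewrite mulr_ge0.
      by rewrite mulr_ge0 ?divr_ge0 ?mulr_ge0 ?ltW.
    by rewrite ler_pM2l ?mulr_gt0.
  lra.
have s2 : cx * W ^+ 3 - cy * P ^+ 3 <= 7 * cmax * G * P ^+ 2 + L0 * zz * P ^+ 3.
  have h1 : (cx - cy) * P ^+ 3 <= L0 * zz * P ^+ 3 by rewrite ler_pM2r.
  (* With [W <= 2 P], the factor [W^2 + W P + P^2] is at most [(4 + 2 + 1) P^2]. *)
  have h2 : W ^+ 3 - P ^+ 3 <= G * (7 * P ^+ 2).
    have -> : W ^+ 3 - P ^+ 3 = (W - P) * (W ^+ 2 + W * P + P ^+ 2) by ring.
    have WPP : W * P <= 2 * P * P by rewrite ler_pM2r.
    have h3 : 0 <= W ^+ 2 + W * P + P ^+ 2.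
      by rewrite !addr_ge0 ?sqr_ge0// mulr_ge0// ltW.
    apply: (le_trans (y := G * (W ^+ 2 + W * P + P ^+ 2))).
      by apply: ler_wpM2r => //; lra.
    by apply: ler_wpM2l => //; lra.
  have h3 : cx * (W ^+ 3 - P ^+ 3) <= cx * (G * (7 * P ^+ 2)) by rewrite ler_wpM2l.
  have h4 : cx * (G * (7 * P ^+ 2)) <= cmax * (G * (7 * P ^+ 2)).
    by rewrite ler_wpM2r// mulr_ge0//; lra.
  lra.
have s3 : 12 * LEZ * G ^+ 2 <= 3 / 16 * del * P ^+ 2.
  have LEZ0 : 0 <= LEZ by rewrite -(pmulr_lge0 _ zz00); lra.
  have h1 : G * (16 * G) <= zz * (del * P).
    by apply: ler_pM => //; [lra|apply: le_trans Gz (ltW zz0)].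
  have := ler_wpM2l LEZ0 h1.
  have -> : LEZ * (zz * (del * P)) = del * P ^+ 2 / 4 by rewrite -LEZE; field.
  lra.
have s4 : 2 * kap * W ^+ 2 <= 8 * kap * P ^+ 2.
  by have := ler_wpM2l k0 W4; lra.
have s5 : (8 * kap + 7 * cmax * G) * P ^+ 2 <= del / 2 * P ^+ 2 by rewrite ler_pM2r.
(* The errors use up [3/16] of [del * P^2] in [s3], [1/2] in [s4] and [s2] through [s5], and [1/4]
   for the loss [4 P G] here: [15/16] in total. *)
have s6 : (1 + del) * (P ^+ 2 - 2 * (P * G)) <= (1 + del) * W ^+ 2.
  by rewrite ler_wpM2l// addr_ge0// ltW.
have s7 : del * (P * G) <= P * G by rewrite ler_piMl// mulr_ge0// ltW.
have s8 : 0 < del * P ^+ 2 by rewrite mulr_gt0.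
lra.
Qed.

Section ContactInequality.
Variable R : realType.
Implicit Types (x y z q : 'rV[R]_2).

Lemma dot_sqr_le x y : dot x y ^+ 2 <= enorm x ^+ 2 * enorm y ^+ 2.
Proof.
rewrite !enorm_sqr /dot; have := sqr_ge0 (x 0 0 * y 0 1 - x 0 1 * y 0 0); lra.
Qed.

(** The first smallness condition serves [|z| <= z0], the other two [|z| > z0]. A zero gradient [q]
    is possible only in the first regime, since in the second [|p| > G]; its curvature bound then
    holds in every direction. *)
Lemma contact_inequality (c m M : 'rV[R]_2 -> R) (D : set 'rV[R]_2)
    (a del kap L mu L0 cmax z0 Emax G ga K r0 t A B C : R) x0 x y q :
  0 < z0 -> z0 <= 1 -> 0 < del -> del <= 1 -> 0 <= kap -> 1 <= L -> 0 <= L0 ->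
  8 * L0 <= mu -> 0 <= t -> expR (mu * t) <= Emax ->
  (forall x, 0 <= c x <= cmax) -> (forall x y, `|c x - c y| <= L0 * enorm (x - y)) ->
  2 * kap * enorm (x - x0) <= G ->
  2 * kap + 12 * (L * Emax) * z0 ^+ 2 + cmax * (G + 4 * (L * Emax) * z0 ^+ 3) <= 1 ->
  16 * G <= del * z0 ^+ 3 -> 8 * kap + 7 * cmax * G <= del / 2 ->
  viscosity_subsolution c D m -> D y -> 0 < r0 -> 1 <= ga ->
  (forall y' s, `|s| < r0 -> M y' <= M y + s -> m y' <= m y + ga * s + K * s ^+ 2) ->
  M y = penalty a del kap L mu x0 x y t ->
  (forall e, 0 < e -> exists2 r : R, 0 < r & forall h, enorm h < r -> forall y',
    M y' <= penalty a del kap L mu x0 (x + h) y'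
      (t + (dot q h + qform (A + e) B (C + e) h))) ->
  - (2 * qform A B C (perp q)) + c x * enorm q ^+ 3 <= enorm q ^+ 2 /\
  (q = 0 -> forall v, - (2 * qform A B C v) <= enorm v ^+ 2).
Proof.
move=> z00 z01 d0 d1 k0 L1 L00 mu0 t0 Em hc hL gG cA cB1 cB2 sv Dy r00 ga1 hM My hA.
have L0' : 0 <= L by lra.
have mup : 0 <= mu by apply: le_trans mu0; rewrite mulr_ge0.
have E1 : 1 <= expR (mu * t) by rewrite -expR0 ler_expR mulr_ge0.
have E0 : 0 <= expR (mu * t) by lra.
have cm0 : 0 <= cmax by have /andP[+ +] := hc 0; exact: le_trans.
pose z := y - x; pose LE := L * expR (mu * t).
have LE1 : 1 <= LE by rewrite /LE mulr_ege1.
have LEm : LE <= L * Emax by rewrite /LE ler_wpM2l.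
have [|st ns] := @contact_stationary _ a del kap L mu x0 x y t q A B C L0'.
  by move=> e /hA[r r0' hr]; exists r => // h /hr/(_ y); rewrite -My.
rewrite -/z -/LE in st ns.
set Ht := speed del L mu z t in st ns.
have HtE : Ht = 1 + del + mu / 4 * (enorm z * (4 * LE * enorm z ^+ 3)).
  by rewrite /Ht /speed -/LE; field.
have zn := enorm_ge0 z.
have Ht1 : 1 <= Ht.
  have h : 0 <= mu / 4 * (enorm z * (4 * LE * enorm z ^+ 3)).
    apply: mulr_ge0; first by rewrite divr_ge0.
    by apply: mulr_ge0 => //; apply: mulr_ge0; [lra|rewrite exprn_ge0].
  lra.
have Ht0 : 0 < Ht by apply: lt_le_trans Ht1.
pose p := (4 * LE * enorm z ^+ 2) *: z; pose g := (2 * kap) *: (x - x0).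
have Htq : Ht *: q = p - g.
  have st' v : dot (Ht *: q) v = dot (p - g) v.
    by rewrite dotZl st (dotBl p) /p /g !dotZl.
  apply: rV2P.
    by have := st' (pt 1 0); rewrite /dot !pt0E !pt1E !mulr0 !mulr1 !addr0.
  by have := st' (pt 0 1); rewrite /dot !pt0E !pt1E !mulr0 !mulr1 !add0r.
have pn : enorm p = 4 * LE * enorm z ^+ 3.
  rewrite /p enormZ ger0_norm; first by ring.
  by apply: mulr_ge0; [lra|exact: sqr_ge0].
have gn : enorm g <= G by rewrite /g enormZ ger0_norm// mulr_ge0.
have qn : Ht * enorm q = enorm (p - g) by rewrite -Htq enormZ gtr0_norm.
have gn0 := enorm_ge0 g; have qn0 := enorm_ge0 q.
have G0 : 0 <= G by apply: le_trans gn.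
have /andP[cx0 cxm] := hc x.
(* If [z] is short the penalty is flat, and minimality in [x] alone bounds the
   curvature at [x].  If [z] is long the equation at [y] is used; the gain
   [mu / 4 * |z| |p|] in [Ht] absorbs [c x - c y]. *)
have [zz0|zz0] := leP (enorm z) z0.
  clear hA hM sv My hc hL cB1 cB2 st r00 ga1 Dy Htq HtE.
  have zz2 : enorm z ^+ 2 <= z0 ^+ 2 by rewrite ler_pXn2r// ?nnegrE// ltW.
  have zz3 : enorm z ^+ 3 <= z0 ^+ 3 by rewrite ler_pXn2r// ?nnegrE// ltW.
  have LEz2 : LE * enorm z ^+ 2 <= L * Emax * z0 ^+ 2.
    by apply: ler_pM => //; [lra|exact: sqr_ge0].
  have LEz3 : LE * enorm z ^+ 3 <= L * Emax * z0 ^+ 3.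
    by apply: ler_pM => //; [lra|exact: exprn_ge0].
  have LEz20 : 0 <= LE * enorm z ^+ 2 by apply: mulr_ge0; [lra|exact: sqr_ge0].
  have qle : enorm q <= G + 4 * (L * Emax) * z0 ^+ 3.
    have h1 : enorm q <= Ht * enorm q by rewrite ler_peMl.
    have h2 : enorm (p - g) <= enorm p + enorm g by rewrite -(enormN g) enormD.
    by rewrite pn in h2; lra.
  have second v : dot q v = 0 ->
      - (2 * qform A B C v) <= (2 * kap + 12 * (L * Emax) * z0 ^+ 2) * enorm v ^+ 2.
    move=> /ns hv; have dv := dot_sqr_le z v.
    have v2 := sqr_ge0 (enorm v).
    have h1 : LE * (dot z v ^+ 2) <= LE * (enorm z ^+ 2 * enorm v ^+ 2).
      by rewrite ler_wpM2l//; lra.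
    have h2 : LE * enorm z ^+ 2 * enorm v ^+ 2 <= L * Emax * z0 ^+ 2 * enorm v ^+ 2.
      by rewrite ler_wpM2r.
    set V := _ * enorm v ^+ 2.
    have V0 : 0 <= V.
      have LEm0 : 0 <= L * Emax by lra.
      by rewrite /V mulr_ge0//; have := mulr_ge0 LEm0 (sqr_ge0 z0); lra.
    have h3 : - V <= Ht * (2 * qform A B C v) by rewrite /V; lra.
    have [Q0|Q0] := leP 0 (2 * qform A B C v); first by lra.
    have : Ht * (2 * qform A B C v) <= 2 * qform A B C v by rewrite ger_nMl.
    lra.
  have tot : 2 * kap + 12 * (L * Emax) * z0 ^+ 2 + cmax * enorm q <= 1.
    by apply: le_trans cA; rewrite lerD2l ler_wpM2l.
  split=> [|q0 v].
    have := second _ (dot_perp q); rewrite enorm_perpE => s1.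
    have h1 : c x * enorm q <= cmax * enorm q by rewrite ler_wpM2r.
    have := ler_wpM2r (sqr_ge0 (enorm q)) tot.
    have := ler_wpM2r (sqr_ge0 (enorm q)) h1; lra.
  have := second v; rewrite q0 => /(_ _)/wrap[]; first by rewrite /dot !mxE; ring.
  move=> /le_trans; apply; rewrite ler_piMl ?sqr_ge0//.
  have : 0 <= cmax * enorm q by rewrite mulr_ge0.
  lra.
have zz00 : 0 < enorm z by apply: lt_trans zz0.
have P0 : 0 < enorm p.
  by rewrite pn mulr_gt0 ?exprn_gt0//; lra.
have p0 : p != 0 by apply: contraTneq P0 => ->; rewrite enorm0 ltxx.
have Pz : z0 ^+ 3 <= enorm p.
  have : z0 ^+ 3 <= enorm z ^+ 3 by rewrite ler_pXn2r// ?nnegrE// ltW.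
  have : enorm z ^+ 3 <= LE * enorm z ^+ 3 by rewrite ler_peMl// exprn_ge0.
  by have := exprn_gt0 3 z00; rewrite pn; lra.
have GP : 16 * G <= del * enorm p by apply: le_trans cB1 _; rewrite ler_pM2l.
have Gz : G <= z0.
  have : z0 ^+ 3 <= z0 by rewrite -[leRHS]expr1 ler_wiXn2l// ltW.
  have : del * z0 ^+ 3 <= z0 ^+ 3 by rewrite ler_piMl// exprn_ge0// ltW.
  lra.
have W1 : enorm p - G <= enorm (p - g).
  have : enorm p <= enorm (p - g) + enorm g by rewrite -{1}(subrK g p) enormD.
  lra.
have W2 : enorm (p - g) <= enorm p + G.
  have : enorm (p - g) <= enorm p + enorm g by rewrite -(enormN g) enormD.
  lra.
have Wpos : 0 < enorm (p - g).
  have : del * enorm p <= enorm p by rewrite ler_piMl// ltW.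
  lra.
have qpos : 0 < enorm q by rewrite -(pmulr_rgt0 _ Ht0) qn.
split=> [|q0]; last by rewrite q0 enorm0 ltxx in qpos.
have := @contact_moving _ a del kap L mu x0 x y t q A B C c m M D ga K r0 L0'
  sv Dy p0 r00 ga1 hM My hA Ht0 Htq.
rewrite -/z -/LE -/p -/g -/Ht => mv.
have lamE : Ht = 1 + del + mu / 4 * (enorm z * enorm p) by rewrite pn.
have LEZ : 4 * (LE * enorm z ^+ 2) * enorm z = enorm p by rewrite pn; ring.
have cxy : c x - c y <= L0 * enorm z.
  by rewrite /z enormBC; apply: le_trans (ler_norm _) (hL x y).
have lam2 : 2 * L0 <= mu / 4 by lra.
have := contact_arith z00 z01 zz0 P0 G0 (ltW Wpos) d0 d1 k0 L00 cx0 cxm cxy lam2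
  lamE LEZ W1 W2 Gz GP cB2.
have dg : LE * dot z (perp g) ^+ 2 <= LE * enorm z ^+ 2 * G ^+ 2.
  rewrite -mulrA ler_wpM2l//; first by lra.
  apply: le_trans (dot_sqr_le _ _) _; rewrite enorm_perpE ler_wpM2l ?sqr_ge0//.
  by rewrite ler_pXn2r// nnegrE.
have dg2 : LE * enorm z ^+ 2 * enorm g ^+ 2 <= LE * enorm z ^+ 2 * G ^+ 2.
  rewrite ler_wpM2l//; first by apply: mulr_ge0; [lra|exact: sqr_ge0].
  by rewrite ler_pXn2r// nnegrE.
(* With [p - g = Ht *: q], the sum of the two inequalities is [Ht^3] times the one to be proved. *)
move: mv; rewrite -Htq perpZ qformZ enormZ gtr0_norm// => mv ar.
have Ht3 : 0 < Ht ^+ 3 by rewrite exprn_gt0.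
rewrite -(ler_pM2l Ht3).
move: (qform _ _ _ _) (dot z _) dg dg2 mv ar => Q dz dg dg2 mv ar.
clear -dg dg2 mv ar; lra.
Qed.

End ContactInequality.

(** * The envelope *)

Section Semicontinuity.
Variable R : realType.
Implicit Types (x y : 'rV[R]_2) (u : 'rV[R]_2 -> R).

Lemma uscP u : upper_semicontinuous u <->
  forall x (al : R), u x < al -> exists2 r : R, 0 < r &
    forall y, enorm (y - x) < r -> u y < al.
Proof.
split=> h x al.
  move=> ual; have := h x (- al); rewrite lte_fin ltrN2 => /(_ ual)[V].
  by move=> /nbhs_enormP[r r0 hr] hV; exists r => // y /hr/hV; rewrite lte_fin ltrN2.
rewrite lte_fin ltrNr => /h[r r0 hr]; exists [set y | enorm (y - x) < r].
  by apply/nbhs_enormP; exists r.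
by move=> y /hr; rewrite lte_fin ltrNr.
Qed.

Lemma compact_eball x (r : R) : compact [set y | enorm (y - x) <= r].
Proof.
apply: bounded_closed_compact.
  exists (r + enorm x); split; first exact: num_real.
  move=> b rb y /= yr; apply: le_trans (ltW rb).
  apply: le_trans (normr_le_enorm _) _; rewrite -{1}(subrK x y).
  by apply: le_trans (enormD _ _) _; rewrite lerD2r.
rewrite -openC openE => y /= /negP; rewrite -ltNge => yr.
apply/nbhs_enormP; exists (enorm (y - x) - r); first by rewrite subr_gt0.
move=> w wy /= wr; have := enormD (y - w) (w - x).
rewrite addrA subrK [enorm (y - w)]enormBC; lra.
Qed.

Lemma usc_max u (K : set 'rV[R]_2) : upper_semicontinuous u -> compact K ->
  K !=set0 -> exists2 x, K x & forall y, K y -> u y <= u x.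
Proof.
move=> /uscP hu; rewrite compact_cover => cK [k0 Kk0].
apply: contrapT => nmax.
have ex x : K x -> exists2 y, K y & u x < u y.
  move=> Kx; apply: contrapT => h; apply: nmax; exists x => // y Ky.
  by rewrite leNgt; apply/negP => uxy; apply: h; exists y.
have [||D DK cov] := cK 'rV[R]_2 K (fun y => [set x | u x < u y]).
- move=> y _; rewrite openE => x /= /hu[r r0 hr].
  by apply/nbhs_enormP; exists r.
- by move=> x /ex[y Ky uxy]; exists y.
have fin : forall s : seq 'rV[R]_2, (forall y, y \in s -> K y) ->
    exists2 x, K x & forall y, y \in s -> u y <= u x.
  elim=> [|y s IH] hs; first by exists k0.
  have [|z Kz hz] := IH; first by move=> w ws; apply: hs; rewrite inE ws orbT.
  have [yz|zy] := leP (u y) (u z).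
    by exists z => // w; rewrite inE => /orP[/eqP->//|/hz].
  exists y => [|w]; first by apply: hs; rewrite mem_head.
  by rewrite inE => /orP[/eqP->//|/hz/le_trans]; apply; exact: ltW.
have [x Kx hx] := fin (finmap.enum_fset D) (fun y yD => set_mem (DK y yD)).
by have [y yD] := cov x Kx; rewrite /= ltNge hx.
Qed.

Lemma usc_sub_continuous u (f : 'rV[R]_2 -> R) : upper_semicontinuous u ->
  (forall x (e : R), 0 < e -> exists2 r : R, 0 < r &
     forall y, enorm (y - x) < r -> f x - e <= f y) ->
  upper_semicontinuous (fun x => u x - f x).
Proof.
move=> /uscP hu hf; apply/uscP => x al ual.
have e0 : 0 < (al - (u x - f x)) / 2 by rewrite divr_gt0// subr_gt0.
have [|r r0 hr] := hu x (u x + (al - (u x - f x)) / 2); first by rewrite ltrDl.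
have [r' r'0 hr'] := hf x _ e0.
exists (Num.min r r') => [|y]; first by rewrite lt_min r0.
by rewrite lt_min => /andP[/hr + /hr']; lra.
Qed.

End Semicontinuity.

(** * The soft minimum and its inversion *)

Section Softmin.
Variable R : realType.
Implicit Types v s t T : R.

(** Smooth and strictly increasing in [v], so a contact for [M] can be pulled back to [m1], where
    the equation is known; a hard minimum would be flat above [T]. *)
Definition softmin T v : R := - ln (expR (- v) + expR (- T)).

Lemma expR_softmin T v : expR (- softmin T v) = expR (- v) + expR (- T).
Proof. by rewrite /softmin opprK lnK// posrE addr_gt0 ?expR_gt0. Qed.

Lemma softmin_lt T v : softmin T v < T.
Proof. by rewrite -ltrN2 -ltr_expR expR_softmin ltrDr expR_gt0. Qed.

Lemma softmin_le T v : softmin T v <= v.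
Proof. by rewrite -lerN2 -ler_expR expR_softmin lerDl expR_ge0. Qed.

Lemma le_softmin T v w : v <= w -> softmin T v <= softmin T w.
Proof. by move=> vw; rewrite -lerN2 -ler_expR !expR_softmin lerD2r ler_expR lerN2. Qed.

Lemma softmin_shift T v s : 0 <= s -> softmin T (v + s) <= softmin T v + s.
Proof.
move=> s0; rewrite -lerN2 -ler_expR expR_softmin !opprD !expRD expR_softmin.
rewrite mulrDl lerD2l ler_piMr ?expR_ge0// -expR0 ler_expR; lra.
Qed.

Lemma softmin_ge T v : T <= v -> T - 1 <= softmin T v.
Proof.
move=> Tv; rewrite -lerN2 -ler_expR expR_softmin opprB addrC expRD.
have h : expR (- v) <= expR (- T) by rewrite ler_expR lerN2.
have := ler_wpM2l (expR_ge0 (- T)) (expR_ge1Dx (1 : R)); lra.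
Qed.

(** A one-sided second order expansion of the inverse function: [ga] is the reciprocal of the slope
    [al / (al + be)] at [v0], and [r0] keeps [X = ga * s] below [1/2], where
    [(1 - X) e^(X + 2 X^2) >= 1]. *)
Lemma softmin_contact T v0 : exists ga, exists K, exists r0, [/\ 1 <= ga, 0 < r0 &
  forall v s, `|s| < r0 -> softmin T v <= softmin T v0 + s ->
    v <= v0 + ga * s + K * s ^+ 2].
Proof.
pose al := expR (- v0); pose be := expR (- T).
have a0 : 0 < al := expR_gt0 _; have b0 : 0 < be := expR_gt0 _.
pose ga := (al + be) / al.
have gaE : ga * al = al + be by rewrite /ga divfK// gt_eqF.
have ga1 : 1 <= ga by rewrite /ga ler_pdivlMr// mul1r lerDl ltW.
exists ga, (2 * ga ^+ 2), (1 / (2 * ga)); split=> //; first by rewrite divr_gt0//; lra.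
move=> v s; rewrite ltr_pdivlMr; last by lra.
move=> sr hs.
have : expR (- (softmin T v0 + s)) <= expR (- softmin T v) by rewrite ler_expR lerN2.
rewrite opprD expRD !expR_softmin -/al -/be => h.
pose X := ga * s.
have X2 : X <= 1 / 2.
  have : X <= `|s| * ga by rewrite /X mulrC ler_wpM2r ?ler_norm//; lra.
  lra.
rewrite -lerN2 -ler_expR.
have -> : - (v0 + ga * s + 2 * ga ^+ 2 * s ^+ 2) = - v0 - (X + 2 * X ^+ 2).
  by rewrite /X; ring.
rewrite expRD -/al.
have h1 : al * (1 - X) <= expR (- v).
  have := ler_wpM2l (ltW (addr_gt0 a0 b0)) (expR_ge1Dx (- s)).
  have -> : al * (1 - X) = (al + be) * (1 - s) - be by rewrite /X -gaE; lra.
  lra.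
apply: le_trans h1; rewrite ler_pM2l//.
set W := X + 2 * X ^+ 2.
have h2 : 1 <= (1 - X) * expR W.
  have X1 : 0 <= 1 - X by lra.
  apply: le_trans (ler_wpM2l X1 (expR_ge1Dx W)).
  have : 0 <= X ^+ 2 * (1 - 2 * X) by rewrite mulr_ge0 ?sqr_ge0//; lra.
  rewrite /W; lra.
have := ler_wpM2l (expR_ge0 (- W)) h2.
by rewrite mulr1 mulrCA [expR (- W) * _]mulrC expRxMexpNx_1 mulr1.
Qed.

End Softmin.

(** * Regularity of the eroded function and attainment of contact *)

Section Envelope.
Variables (R : realType) (a del kap L mu T : R) (x0 : 'rV[R]_2) (M : 'rV[R]_2 -> R).
Implicit Types (x y : 'rV[R]_2) (s t : R).
Hypotheses (a_ge0 : 0 <= a) (del_ge0 : 0 <= del) (kap_ge0 : 0 <= kap)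
  (L_ge1 : 1 <= L) (mu_ge0 : 0 <= mu) (T_ge0 : 0 <= T)
  (M_usc : upper_semicontinuous M) (M_lt : forall y, M y < T).

Notation pen := (penalty a del kap L mu x0).

(** Admitting [t = 0] unconditionally keeps the supremum nonnegative; contact is claimed only where
    it is positive. *)
Definition reach x : set R := [set t | 0 <= t /\ (t = 0 \/ exists y, pen x y t <= M y)].

(* For [t >= 0] the sublevel set [envelope < t] consists, roughly, of the points
   whose neighbourhood of size comparable to [expR (- mu * t / 4)] lies in
   [M < t]: a space-time erosion which shrinks as [t] grows. *)
Definition envelope x : R := sup (reach x).

Lemma L_ge0 : 0 <= L.
Proof. exact: le_trans ler01 L_ge1. Qed.

Lemma penalty_increment x y s t : s <= t -> pen x y s + (t - s) <= pen x y t.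
Proof.
move=> st; rewrite /penalty.
have h1 : expR (mu * s) <= expR (mu * t) by rewrite ler_expR ler_wpM2l.
have h2 := ler_wpM2r (sqr_ge0 (enorm (y - x) ^+ 2)) h1.
have L0 := L_ge0.
have h3 := ler_wpM2l L0 h2.
have h4 : 0 <= del * (t - s) by rewrite mulr_ge0// subr_ge0.
lra.
Qed.

Lemma penalty_decrement x y s t : s <= t -> pen x y t <= pen x y s
  + (t - s) * (1 + del + mu * (L * (expR (mu * t) * (enorm (y - x) ^+ 2) ^+ 2))).
Proof.
move=> st; rewrite /penalty.
have h1 : expR (mu * t) * (1 - mu * (t - s)) <= expR (mu * s).
  have -> : mu * s = mu * t + mu * (s - t) by ring.
  rewrite expRD ler_wpM2l ?expR_ge0//.
  have := expR_ge1Dx (mu * (s - t)); lra.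
have h2 := ler_wpM2r (sqr_ge0 (enorm (y - x) ^+ 2)) h1.
have L0 := L_ge0.
have h3 := ler_wpM2l L0 h2.
lra.
Qed.

Lemma penalty_ge x y t : 0 <= t -> t + L * (enorm (y - x) ^+ 2) ^+ 2 <= pen x y t.
Proof.
move=> t0; rewrite /penalty.
have E1 : 1 <= expR (mu * t) by rewrite -expR0 ler_expR mulr_ge0.
have h2 := ler_wpM2r (sqr_ge0 (enorm (y - x) ^+ 2)) E1.
have L0 := L_ge0.
have h3 := ler_wpM2l L0 h2.
have h4 : 0 <= kap * enorm (x - x0) ^+ 2 by rewrite mulr_ge0 ?sqr_ge0.
have h5 : 0 <= del * t by rewrite mulr_ge0.
have a0 := a_ge0; rewrite mul1r in h3; lra.
Qed.

Lemma reach_le x t : reach x t -> t <= T.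
Proof.
move=> [t0 [->//|[y hy]]].
have := penalty_ge x y t0; have := M_lt y.
have : 0 <= L * (enorm (y - x) ^+ 2) ^+ 2 by rewrite mulr_ge0 ?sqr_ge0// L_ge0.
lra.
Qed.

Lemma reach0 x : reach x 0.
Proof. by split=> //; left. Qed.

Lemma reach_has_sup x : has_sup (reach x).
Proof. by split; [exists 0; exact: reach0|exists T => t; exact: reach_le]. Qed.

Lemma envelope_ge x t : reach x t -> t <= envelope x.
Proof. by apply: ub_le_sup; exists T => s; exact: reach_le. Qed.

Lemma envelope_ge0 x : 0 <= envelope x.
Proof. exact/envelope_ge/reach0. Qed.

Lemma envelope_le x t : (forall s, reach x s -> s <= t) -> envelope x <= t.
Proof. by move=> h; apply: ge_sup => //; exists 0; exact: reach0. Qed.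

Lemma envelope_leT x : envelope x <= T.
Proof. by apply: envelope_le => s; exact: reach_le. Qed.

Lemma lt_penalty x y t : envelope x < t -> M y < pen x y t.
Proof.
move=> ut; rewrite ltNge; apply/negP => h.
have t0 : 0 <= t by apply: le_trans (envelope_ge0 x) (ltW ut).
have : t <= envelope x by apply: envelope_ge; split=> //; right; exists y.
by rewrite leNgt ut.
Qed.

(** Above the supremum the inequality is strict by definition, and continuity in [t] adds the
    endpoint. Used at displaced points, with [t] bounded by a test function, it gives the hypothesis
    of the contact lemmas. *)
Lemma le_penalty x y t : envelope x <= t -> M y <= pen x y t.
Proof.
move=> ut; apply/ler_addgt0Pr => e e0.
pose K := 1 + del + mu * (L * (expR (mu * (t + 1)) * (enorm (y - x) ^+ 2) ^+ 2)).
have L0 := L_ge0.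
have K1 : 1 <= K.
  rewrite /K -addrA lerDl addr_ge0// mulr_ge0// mulr_ge0//.
  by rewrite mulr_ge0 ?expR_ge0 ?sqr_ge0.
pose s := Num.min 1 (e / K).
have s0 : 0 < s by rewrite lt_min ltr01 divr_gt0//; lra.
have s1 : s <= 1 by rewrite ge_min lexx.
have sK : s * K <= e.
  by rewrite -ler_pdivlMr ?ge_min ?lexx ?orbT//; lra.
have ts : t <= t + s by lra.
have h1 : M y < pen x y (t + s) by apply: lt_penalty; lra.
have := penalty_decrement x y ts; rewrite (_ : t + s - t = s); last by ring.
set K' := 1 + del + _.
have KK : K' <= K.
  rewrite lerD2l ler_wpM2l// ler_wpM2l// ler_wpM2r ?sqr_ge0//.
  by rewrite ler_expR ler_wpM2l// lerD2l.
have := ler_wpM2l (ltW s0) KK; lra.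
Qed.

Lemma reach_close x y t : 0 <= t -> pen x y t <= M y -> enorm (y - x) <= 1 + T.
Proof.
move=> t0 h; rewrite leNgt; apply/negP => yx.
have T0 := T_ge0; have d1 : 1 <= enorm (y - x) by lra.
have d2 : enorm (y - x) <= enorm (y - x) ^+ 2 by rewrite ler_eXnr.
have d4 : enorm (y - x) ^+ 2 <= (enorm (y - x) ^+ 2) ^+ 2.
  by rewrite ler_eXnr// (le_trans d1).
have L0 := L_ge0.
have d5 : (enorm (y - x) ^+ 2) ^+ 2 <= L * (enorm (y - x) ^+ 2) ^+ 2.
  by rewrite ler_peMl// sqr_ge0.
have := penalty_ge x y t0; have := M_lt y; lra.
Qed.

(** The tangent line bound for the convex function [d^4]; it controls the quartic term when a point
    moves by at most [e]. *)
Lemma quartic_lower (d d' e : R) : 0 <= d -> 0 <= d' -> 0 <= e -> d <= d' + e ->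
  d ^+ 4 - 4 * d ^+ 3 * e <= d' ^+ 4.
Proof.
move=> d0 d'0 e0 dd.
have [de|ed] := leP d e.
  have h1 : d ^+ 4 <= 4 * d ^+ 3 * e.
    rewrite exprSr; have h : d ^+ 3 * d <= d ^+ 3 * e by rewrite ler_wpM2l// exprn_ge0.
    have : 0 <= d ^+ 3 * e by rewrite mulr_ge0// exprn_ge0.
    lra.
  by have := exprn_ge0 4 d'0; lra.
have h1 : (d - e) ^+ 4 <= d' ^+ 4 by rewrite lerXn2r ?nnegrE//; lra.
apply: le_trans h1.
have -> : (d - e) ^+ 4 = d ^+ 4 - 4 * d ^+ 3 * e + e ^+ 2 * (6 * d ^+ 2 - 4 * d * e + e ^+ 2).
  by ring.
rewrite lerDl mulr_ge0 ?sqr_ge0//.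
have := sqr_ge0 (2 * d - e); have := sqr_ge0 d; lra.
Qed.

Lemma penalty_lower x x' y t e : 0 <= t -> 0 <= e -> e <= 1 -> enorm (x' - x) <= e ->
  enorm (y - x) <= 2 + T ->
  pen x y t - e * (2 * kap * enorm (x - x0)
     + L * expR (mu * t) * (4 * (2 + T) ^+ 3)) <= pen x' y t.
Proof.
move=> t0 e0 e1 xx yx; have T0 := T_ge0; rewrite /penalty.
have L0 := L_ge0.
have LE0 : 0 <= L * expR (mu * t) by rewrite mulr_ge0 ?expR_ge0.
have n1 := enorm_ge0 (y - x); have n2 := enorm_ge0 (y - x').
have n3 := enorm_ge0 (x - x0); have n4 := enorm_ge0 (x' - x0).
have tri1 : enorm (y - x) <= enorm (y - x') + e.
  by rewrite -(subrKA x'); apply: le_trans (enormD _ _) _; rewrite lerD2l.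
have tri2 : enorm (x - x0) <= enorm (x' - x0) + e.
  rewrite -(subrKA x'); apply: le_trans (enormD _ _) _; rewrite addrC lerD2l.
  by rewrite enormBC.
have h1 := quartic_lower n1 n2 e0 tri1.
have h2 : enorm (x - x0) ^+ 2 - 2 * enorm (x - x0) * e <= enorm (x' - x0) ^+ 2.
  have [A|A] := leP (enorm (x - x0)) e.
    have : enorm (x - x0) * enorm (x - x0) <= enorm (x - x0) * e by rewrite ler_wpM2l.
    have := sqr_ge0 (enorm (x' - x0)); have : 0 <= enorm (x - x0) * e by rewrite mulr_ge0.
    lra.
  have : (enorm (x - x0) - e) ^+ 2 <= enorm (x' - x0) ^+ 2.
    by rewrite lerXn2r ?nnegrE//; lra.
  have := sqr_ge0 e; lra.
have h3 := ler_wpM2l kap_ge0 h2.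
have h4 : enorm (y - x) ^+ 3 * e <= (2 + T) ^+ 3 * e.
  by rewrite ler_wpM2r// lerXn2r ?nnegrE//; lra.
have h5 : enorm (y - x) ^+ 4 - 4 * ((2 + T) ^+ 3 * e) <= enorm (y - x') ^+ 4 by lra.
have := ler_wpM2l LE0 h5.
rewrite -!exprM; lra.
Qed.

Lemma envelope_usc : upper_semicontinuous envelope.
Proof.
apply/uscP => x al ual.
(* Two levels between [envelope x] and [al]: the gap [t - t'] pays for replacing [x] by a nearby
   [x']. *)
pose t := envelope x + (al - envelope x) * (2 / 3).
pose t' := envelope x + (al - envelope x) / 3.
have u0 := envelope_ge0 x.
have [tt tal ut'] : [/\ t' < t, t < al & envelope x < t'] by rewrite /t /t'; split; lra.
have t0 : 0 <= t by lra.
pose Q := 2 * kap * enorm (x - x0) + L * expR (mu * t) * (4 * (2 + T) ^+ 3).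
have L0 := L_ge0.
have T0 := T_ge0; have T2 : 0 <= 2 + T by lra.
have Q0 : 0 <= Q.
  apply: addr_ge0; first by rewrite mulr_ge0 ?enorm_ge0// mulr_ge0.
  by rewrite mulr_ge0 ?mulr_ge0 ?expR_ge0 ?exprn_ge0.
pose e := Num.min 1 ((t - t') / (Q + 1)).
have Q1 : 0 < Q + 1 by lra.
have e0 : 0 < e by rewrite lt_min ltr01 divr_gt0// subr_gt0.
have e1 : e <= 1 by rewrite ge_min lexx.
have eQ : e * (Q + 1) <= t - t' by rewrite -ler_pdivlMr// ge_min lexx orbT.
exists e => // x' xx'; apply: le_lt_trans tal; apply: envelope_le => s [s0 hs].
rewrite leNgt; apply/negP => ts; case: hs => [s00|[y hy]]; first by lra.
have hyt : pen x' y t <= M y.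
  by have := penalty_increment x' y (ltW ts); lra.
have yx' := reach_close t0 hyt.
have yx : enorm (y - x) <= 2 + T.
  rewrite -(subrKA x'); apply: le_trans (enormD _ _) _; lra.
have := penalty_lower t0 (ltW e0) e1 (ltW xx') yx; rewrite -/Q.
have := penalty_increment x y (ltW tt); have := lt_penalty y ut'.
lra.
Qed.

Lemma envelope_attained x : 0 < envelope x ->
  exists y, M y = pen x y (envelope x).
Proof.
move=> u0; set u := envelope x in u0 *.
pose f y := M y - L * (expR (mu * u) * (enorm (y - x) ^+ 2) ^+ 2).
pose b := (1 + del) * u + a + kap * enorm (x - x0) ^+ 2.
have fE y : M y - pen x y u = f y - b by rewrite /f /b /penalty; ring.
have L0 := L_ge0; have T0 := T_ge0.
have LE0 : 0 <= L * expR (mu * u) by rewrite mulr_ge0 ?expR_ge0.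
have uscf : upper_semicontinuous f.
  apply: usc_sub_continuous => // y e e0.
  pose d := enorm (y - x).
  have d0 : 0 <= d := enorm_ge0 _.
  pose K := L * expR (mu * u) * (4 * d ^+ 3) + 1.
  have K0 : 0 < K by rewrite ltr_wpDl// mulr_ge0// mulr_ge0// exprn_ge0.
  exists (e / K) => [|y' yy']; first by rewrite divr_gt0.
  have n' := enorm_ge0 (y' - x); have ny := enorm_ge0 (y' - y).
  have tri : d <= enorm (y' - x) + enorm (y' - y).
    rewrite /d -(subrKA y'); apply: le_trans (enormD _ _) _.
    by rewrite addrC lerD2l enormBC.
  have h := quartic_lower d0 n' ny tri.
  have h2 := ler_wpM2l LE0 h.
  move: yy'; rewrite ltr_pdivlMr// /K -/d -!exprM /= => yy'.
  lra.
have [|z Kz hz] := usc_max uscf (@compact_eball _ x (1 + T)).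
  by exists x => /=; rewrite subrr enorm0 addr_ge0.
exists z; apply/eqP; rewrite eq_le le_penalty//= leNgt; apply/negP => lt.
pose K := 1 + del + mu * (L * expR (mu * u) * ((1 + T) ^+ 2) ^+ 2).
have K1 : 1 <= K.
  by rewrite /K -addrA lerDl addr_ge0// mulr_ge0// mulr_ge0// sqr_ge0.
(* [K] bounds the slope in [t] over the ball that contains every competitor, so a level within [s]
   of [u] would beat the maximiser [z]. Taking [s <= u] rules out the default element [t = 0]. *)
pose s := Num.min u ((pen x z u - M z) / K).
have K0 : 0 < K by lra.
have s0 : 0 < s by rewrite lt_min u0 divr_gt0// subr_gt0.
have su : s <= u by rewrite ge_min lexx.
have sK : s * K <= pen x z u - M z by rewrite -ler_pdivlMr// ge_min lexx orbT.
have [t ht tu] := sup_adherent s0 (reach_has_sup x).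
rewrite -/(envelope x) -/u in tu.
have tle := envelope_ge ht; rewrite -/u in tle.
case: ht => t0 [t00|[y hy]]; first by lra.
have ycl := reach_close t0 hy.
have := penalty_decrement x y tle; set K' := 1 + del + _.
have KK : K' <= K.
  rewrite lerD2l ler_wpM2l// mulrA ler_wpM2l//.
  rewrite lerXn2r ?nnegrE ?sqr_ge0// lerXn2r ?nnegrE ?enorm_ge0//; lra.
have h1 : (u - t) * K' <= (u - t) * K by rewrite ler_wpM2l// subr_ge0.
have h2 : (u - t) * K < s * K by rewrite ltr_pM2r//; lra.
have := hz _ ycl; have := fE y; have := fE z; lra.
Qed.

Lemma envelope_le0 x : (forall y, M y <= pen x y 0) -> envelope x <= 0.
Proof.
move=> h; apply: envelope_le => s [s0 [->//|[y hy]]].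
rewrite leNgt; apply/negP => s00.
by have := penalty_increment x y s0; have := h y; lra.
Qed.

Lemma envelope_base : 0 <= M x0 - a -> (M x0 - a) / (1 + del) <= envelope x0.
Proof.
move=> h; apply: envelope_ge; split; first by rewrite divr_ge0// addr_ge0.
right; exists x0; rewrite /penalty !subrr enorm0 !expr2 !mulr0 !addr0.
have d1 : 1 + del != 0 by rewrite gt_eqF// ltr_wpDr.
by rewrite [(1 + del) * _]mulrC divfK// subrK.
Qed.

End Envelope.

(** * Localised comparison *)

Section Step.
Variable R : realType.
Implicit Types (x y : 'rV[R]_2).

(* With [rho] the radius of the localisation and [T] the elapsed time, the three
   inequalities are the smallness conditions of [contact_inequality] for
   [del = T^-1], [kap = T / rho ^+ 2], [mu = 8 * L0] and [G = 2 * T / rho]. *)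
Definition admissible_rate (L cmax L0 C1 : R) : Prop :=
  forall T rho : R, 1 <= T -> expR (C1 * T) <= rho ->
    exists z0 : R, [/\ 0 < z0, z0 <= 1,
      2 * (T / rho ^+ 2) + 12 * (L * expR (8 * L0 * T)) * z0 ^+ 2
        + cmax * (2 * T / rho + 4 * (L * expR (8 * L0 * T)) * z0 ^+ 3) <= 1,
      16 * (2 * T / rho) <= T^-1 * z0 ^+ 3 &
      8 * (T / rho ^+ 2) + 7 * cmax * (2 * T / rho) <= T^-1 / 2].

(** With [E = e^(8 L0 T)] and [z0 = 1 / (Kc E)], all conditions follow from [rho >= K1 T^2 E^3]. In
    the exponent, [24 * L0] yields [E^3], [2] yields [T^2], and [K1] yields the factor [K1]. *)
Lemma admissible_rate_exists (L cmax L0 : R) : 1 <= L -> 0 <= cmax -> 0 <= L0 ->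
  exists2 C1 : R, 1 <= C1 & admissible_rate L cmax L0 C1.
Proof.
move=> L1 c0 L00.
(* Makes each of the two quartic terms in the first condition at most [1/4]. *)
pose Kc := 48 * L + 16 * (cmax * L) + 1.
have cL0 : 0 <= cmax * L by rewrite mulr_ge0//; lra.
have Kc1 : 1 <= Kc by rewrite /Kc; lra.
pose K1 := 32 * Kc ^+ 3 + 16 + 28 * cmax.
have Kc3 : 1 <= Kc ^+ 3 by rewrite exprn_ege1.
exists (24 * L0 + 2 + K1) => [|T rho T1 hrho]; first by rewrite /K1; lra.
set E := expR (8 * L0 * T).
have E1 : 1 <= E by rewrite -expR0 ler_expR mulr_ge0//; [rewrite mulr_ge0|lra].
have E0 : 0 < E by lra.
have T0 : 0 < T by lra.
have rho_ge : K1 * (T ^+ 2 * E ^+ 3) <= rho.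
  apply: le_trans hrho.
  have -> : (24 * L0 + 2 + K1) * T = K1 * T + (T + T + (8 * L0 * T + 8 * L0 * T + 8 * L0 * T)).
    by ring.
  rewrite !expRD -/E -!expr2 -exprSr.
  have hT : T <= expR T by have := expR_ge1Dx T; lra.
  have hK : K1 <= expR (K1 * T).
    have := expR_ge1Dx (K1 * T); have : K1 <= K1 * T by rewrite ler_peMr// /K1; lra.
    lra.
  have K10 : 0 <= K1 by rewrite /K1; lra.
  apply: ler_pM => //; first by rewrite mulr_ge0 ?sqr_ge0// exprn_ge0// ltW.
  rewrite ler_wpM2r ?exprn_ge0 ?(ltW E0)//.
  by rewrite lerXn2r// nnegrE; [exact: ltW|exact: expR_ge0].
have E3 : 1 <= E ^+ 3 by rewrite exprn_ege1.
have T2 : 1 <= T ^+ 2 by rewrite exprn_ege1.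
have TE : 1 <= T ^+ 2 * E ^+ 3 by rewrite mulr_ege1.
have TTE : T ^+ 2 <= T ^+ 2 * E ^+ 3 by rewrite ler_peMr// sqr_ge0.
have rho1 : 1 <= rho.
  apply: le_trans rho_ge; rewrite mulr_ege1//; rewrite /K1; lra.
have rho0 : 0 < rho by lra.
have ir0 : 0 < rho^-1 by rewrite invr_gt0.
have KE0 : 0 < Kc * E by rewrite mulr_gt0//; lra.
pose z0 := (Kc * E)^-1.
have z00 : 0 < z0 by rewrite invr_gt0.
have KE1 : 1 <= Kc * E by rewrite mulr_ege1.
have z01 : z0 <= 1 by rewrite invf_le1.
have rr : rho^-1 ^+ 2 <= rho^-1.
  by rewrite expr2 ler_piMl ?(ltW ir0)// invf_le1.
have cB2 : 8 * (T / rho ^+ 2) + 7 * cmax * (2 * T / rho) <= T^-1 / 2.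
  have h1 : (T ^+ 2 * (16 + 28 * cmax)) <= rho.
    apply: le_trans rho_ge; rewrite mulrC; apply: ler_pM => //; first by lra.
      by lra.
    by rewrite /K1; lra.
  have h2 : T * (8 + 14 * cmax) / rho <= T^-1 / 2.
    rewrite ler_pdivrMr// -(ler_pM2l T0) (_ : T * (T^-1 / 2 * rho) = rho / 2); first lra.
    by field; rewrite gt_eqF.
  apply: le_trans h2; rewrite -exprVn.
  have := ler_wpM2l (ltW T0) rr; lra.
exists z0; split=> //.
  have iT : T^-1 <= 1 by rewrite invf_le1.
  have k0 : 0 <= T / rho ^+ 2 by rewrite divr_ge0 ?sqr_ge0// ltW.
  have g0 : 0 <= cmax * (2 * T / rho) by rewrite mulr_ge0// divr_ge0 ?mulr_ge0 ?ltW.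
  have zE : z0 * E = Kc^-1 by rewrite /z0 invfM mulfVK// gt_eqF.
  have h1 : E * z0 ^+ 2 <= Kc^-1.
    by rewrite -zE expr2 mulrA [E * z0]mulrC ler_piMr// mulr_ge0// ltW.
  have h2 : E * z0 ^+ 3 <= Kc^-1.
    apply: le_trans h1; rewrite ler_pM2l// exprSr ler_piMr// sqr_ge0//.
  have h3 : 12 * L * Kc^-1 <= 1 / 4.
    by rewrite ler_pdivrMr; [rewrite /Kc|]; lra.
  have h4 : 4 * (cmax * L) * Kc^-1 <= 1 / 4.
    by rewrite ler_pdivrMr; [rewrite /Kc|]; lra.
  have h5 := ler_wpM2l (_ : 0 <= 12 * L) h1.
  have h6 := ler_wpM2l (_ : 0 <= 4 * (cmax * L)) h2.
  have {}h5 := h5 (ltac:(lra)); have {}h6 := h6 (ltac:(lra)).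
  lra.
rewrite mulrA ler_pdivrMr// -(ler_pM2l T0).
have -> : T * (T^-1 * z0 ^+ 3 * rho) = rho / (Kc * E) ^+ 3.
  by rewrite /z0 exprVn -mulrA mulVKf ?gt_eqF// mulrC.
rewrite ler_pdivlMr ?exprn_gt0// exprMn; apply: le_trans rho_ge.
have : 32 * Kc ^+ 3 * (T ^+ 2 * E ^+ 3) <= K1 * (T ^+ 2 * E ^+ 3).
  by rewrite ler_pM2r; [rewrite /K1|]; lra.
lra.
Qed.

Lemma trace_perp_proj_e1 (X : 'M[R]_2) : \tr (perp_proj (pt 1 0) *m X) = X 1 1.
Proof.
have n1 : enorm (pt 1 0 : 'rV[R]_2) ^+ 2 = 1 by rewrite enorm_sqr pt0E pt1E; ring.
rewrite /mxtrace sum2E !mxE !sum2E !mxE !big_ord1 !mxE /= n1 invr1.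
by ring.
Qed.

Lemma envelope_subsol (c m : 'rV[R]_2 -> R) (D : set 'rV[R]_2)
    (a L L0 cmax T rho z0 t1 : R) x0 x (phi : 'rV[R]_2 -> R) :
  0 <= a -> 1 <= L -> 0 <= L0 -> 1 <= T -> 0 < rho -> 0 < z0 -> z0 <= 1 ->
  2 * (T / rho ^+ 2) + 12 * (L * expR (8 * L0 * T)) * z0 ^+ 2
    + cmax * (2 * T / rho + 4 * (L * expR (8 * L0 * T)) * z0 ^+ 3) <= 1 ->
  16 * (2 * T / rho) <= T^-1 * z0 ^+ 3 ->
  8 * (T / rho ^+ 2) + 7 * cmax * (2 * T / rho) <= T^-1 / 2 ->
  (forall x, 0 <= c x <= cmax) -> (forall x y, `|c x - c y| <= L0 * enorm (x - y)) ->
  viscosity_subsolution c D m -> upper_semicontinuous (fun y => softmin T (m y - t1)) ->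
  (forall y, t1 < m y -> D y) ->
  let u := envelope a T^-1 (T / rho ^+ 2) L (8 * L0) x0 (fun y => softmin T (m y - t1)) in
  class_C 2 phi -> 0 < u x -> (\forall y \near x, u y - phi y <= u x - phi x) ->
  subsol_ineq c x (grad phi x) (hess phi x).
Proof.
move=> a0 L1 L00 T1 rho0 z00 z01 cA cB1 cB2 hc hL sv uscM hD u phi2 ux touch.
have T0 : 0 < T by lra.
have T0' := ltW T0.
have d0 : 0 < T^-1 by rewrite invr_gt0.
have d1 : T^-1 <= 1 by rewrite invf_le1.
have k0 : 0 <= T / rho ^+ 2 by rewrite divr_ge0 ?sqr_ge0.
have mu0 : 0 <= 8 * L0 by rewrite mulr_ge0.
have Mlt y : softmin T (m y - t1) < T := softmin_lt _ _.
have [y My] := envelope_attained a0 (ltW d0) k0 L1 mu0 T0' uscM Mlt ux.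
rewrite -/u in My.
have pge := penalty_ge x0 a0 (ltW d0) k0 L1 mu0 x y (ltW ux).
have L4 : 0 <= L * (enorm (y - x) ^+ 2) ^+ 2 by rewrite mulr_ge0 ?sqr_ge0//; lra.
(* The penalty is positive when [u x > 0], and [softmin] lies below [m - t1]; hence [m y > t1]. *)
have Dy : D y.
  apply: hD; have := softmin_le T (m y - t1); rewrite My; lra.
have [ga [K [r0 [ga1 r00 hga]]]] := softmin_contact T (m y - t1).
pose q := grad phi x; pose A := hess phi x 0 0 / 2.
pose B := (hess phi x 0 1 + hess phi x 1 0) / 2; pose C := hess phi x 1 1 / 2.
have hM : forall y' s, `|s| < r0 -> softmin T (m y' - t1) <= softmin T (m y - t1) + s ->
    m y' <= m y + ga * s + K * s ^+ 2.
  by move=> y' s sr /(hga _ _ sr); lra.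
have uT : u x <= T := envelope_leT x0 a0 (ltW d0) k0 L1 mu0 T0' Mlt x.
have Em : expR (8 * L0 * u x) <= expR (8 * L0 * T) by rewrite ler_expR ler_wpM2l.
(* At a contact the cut-off is at most [M y < T], which confines [x] to the ball of radius [rho]. *)
have gG : 2 * (T / rho ^+ 2) * enorm (x - x0) <= 2 * T / rho.
  have h : T / rho ^+ 2 * enorm (x - x0) ^+ 2 <= T.
    apply: le_trans (ltW (Mlt y)); rewrite My /penalty.
    have L0' : 0 <= L by lra.
    have : 0 <= (1 + T^-1) * u x by apply: mulr_ge0; [lra|exact: ltW].
    have : 0 <= L * (expR (8 * L0 * u x) * (enorm (y - x) ^+ 2) ^+ 2).
      by apply: mulr_ge0 => //; apply: mulr_ge0; [exact: expR_ge0|exact: sqr_ge0].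
    lra.
  have h2 : enorm (x - x0) <= rho.
    rewrite -(@ler_pXn2r _ 2)// ?nnegrE ?enorm_ge0 ?(ltW rho0)//.
    have r2 : 0 < rho ^+ 2 by rewrite exprn_gt0.
    move: h; rewrite mulrAC ler_pdivrMr// ler_pM2l//.
  have -> : 2 * T / rho = 2 * (T / rho ^+ 2) * rho.
    by field; rewrite gt_eqF.
  by rewrite ler_wpM2l// mulr_ge0.
(* Touching and Taylor's inequality bound [u (x + h)] by the quadratic in [h], so [le_penalty]
   applies at that level. *)
have cont e : 0 < e -> exists2 r : R, 0 < r & forall h, enorm h < r -> forall y',
    softmin T (m y' - t1) <= penalty a T^-1 (T / rho ^+ 2) L (8 * L0) x0 (x + h) y'
      (u x + (dot q h + qform (A + e) B (C + e) h)).
  move=> e0; have [r r0' hr] := taylor2 x phi2 e0.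
  have [r' r'0 hr'] := (nbhs_enormP _ _).1 touch.
  exists (Num.min r r') => [|h]; first by rewrite lt_min r0'.
  rewrite lt_min => /andP[/hr h1 h2] y'.
  apply: (le_penalty a0 (ltW d0) k0 L1 mu0 T0' Mlt).
  have := hr' (x + h); rewrite [x + h]addrC addrK => /(_ h2); rewrite addrC -/u => h3.
  move: h1; rewrite enorm_sqr /dot /qform /q /A /B /C.
  lra.
have [main z] := contact_inequality z00 z01 d0 d1 k0 L1 L00 (lexx _) (ltW ux) Em hc hL gG
  cA cB1 cB2 sv Dy r00 ga1 hM My cont.
have [q0|qn0] := eqVneq (grad phi x) 0; last first.
  apply/subsol_ineqE => //.
  move: main; rewrite /qform /perp pt0E pt1E /A /B /C /q; lra.
split=> [|_]; first by rewrite q0 eqxx.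
exists (pt 1 0).
  by rewrite enormE pt0E pt1E expr1n expr0n addr0 sqrtr1.
have := z q0 (pt 0 1).
have -> : enorm (pt 0 1 : 'rV[R]_2) ^+ 2 = 1 by rewrite enorm_sqr pt0E pt1E; ring.
rewrite /qform pt0E pt1E trace_perp_proj_e1 /C.
move: (hess phi x 1 1) => X; clear; lra.
Qed.

End Step.

(** * Properties of arrival times and one step of the comparison *)

Section Comparison.
Variable R : realType.
Implicit Types (x y : 'rV[R]_2) (c m : 'rV[R]_2 -> R) (S Z : set 'rV[R]_2).

(** By maximality it suffices that zero is a subsolution: a test function touching it from above has
    a local minimum, hence zero gradient and nonnegative Hessian form. *)
Lemma arrival_time_ge0 c S m x : arrival_time c S m -> 0 <= m x.
Proof.
move=> [_ _ mmax]; apply: (mmax (fun=> 0)); split=> // [y al h|phi y phi2 _ touch].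
  by exists setT => //; exact: filterT.
have {touch} [r r0 hr] := (nbhs_enormP _ _).1 touch.
have key e v : 0 < e -> dot (grad phi y) v = 0 /\ 0 <=
    qform (hess phi y 0 0 / 2 + e) ((hess phi y 0 1 + hess phi y 1 0) / 2)
      (hess phi y 1 1 / 2 + e) v.
  move=> e0; have [r' r'0 hr'] := taylor2 y phi2 e0.
  have v1 : 0 < enorm v + 1 by rewrite ltr_wpDl ?enorm_ge0.
  apply: (@cubic_sign _ _ _ 0 (Num.min r r' / (enorm v + 1))) => [|s].
    by rewrite divr_gt0// lt_min r0.
  rewrite ltr_pdivlMr// lt_min => /andP[sr sr'].
  have sv : enorm (s *: v) <= `|s| * (enorm v + 1).
    by rewrite enormZ ler_wpM2l// lerDl.
  have := hr (y + s *: v); rewrite [y + _]addrC addrK => /(_ (le_lt_trans sv sr)).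
  have := hr' _ (le_lt_trans sv sr'); rewrite [y + _]addrC enorm_sqr !mxE /dot /qform !mxE.
  move: (phi _) (phi y) (partial 0 phi y) (partial 1 phi y) (v 0 0) (v 0 1)
    (partial 0 (partial 0 phi) y) (partial 0 (partial 1 phi) y)
    (partial 1 (partial 0 phi) y) (partial 1 (partial 1 phi) y).
  clear; move=> *; lra.
have g0 : grad phi y = 0.
  apply: rV2P; rewrite [RHS]mxE.
    have [+ _] := key 1 (pt 1 0) ltr01.
    by rewrite /dot pt0E pt1E !(mulr1, mulr0, addr0).
  have [+ _] := key 1 (pt 0 1) ltr01.
  by rewrite /dot pt0E pt1E !(mulr1, mulr0, add0r).
split=> [|_]; first by rewrite g0 eqxx.
exists (pt 1 0).
  by rewrite enormE pt0E pt1E expr1n expr0n addr0 sqrtr1.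
rewrite trace_perp_proj_e1.
have h2 : 0 < 1 / 2 :> R by lra.
have [_] := key _ (pt 0 1) h2.
rewrite /qform pt0E pt1E; move: (hess phi y 1 1) => X; clear; lra.
Qed.

(** The assumed bound concerns points off [S]. If [x] is in [S] and [y] is not, walk from [y]
    towards [x] to the first point of [S]: upper semicontinuity makes [m] small just before it, and
    the bound applies between there and [y]. *)
Lemma lipschitz_bound_extend c S m (tau L t : R) x y : 0 <= tau -> 0 <= L ->
  closed S -> arrival_time c S m -> lipschitz_bound tau L S m ->
  0 <= t -> m x <= t -> m y <= t + tau + L * enorm (y - x).
Proof.
move=> tau0 L0 cS [[/uscP uscm _ _] mS _] lip t0 mxt.
have Ld : 0 <= L * enorm (y - x) by rewrite mulr_ge0 ?enorm_ge0.
have [Sy|nSy] := pselect (S y); first by rewrite mS//; lra.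
have [Sx|nSx] := pselect (S x); last first.
  by have := le_trans (ler_norm _) (lip y x nSy nSx); lra.
pose p (s : R) := y + s *: (x - y).
have pp s s' : p s - p s' = (s - s') *: (x - y).
  by rewrite /p opprD addrACA subrr add0r -scalerBl.
pose A : set R := [set s | 0 <= s /\ S (p s)].
have A1 : A 1 by split=> //; rewrite /p scale1r addrC subrK.
have infA : has_inf A by split; [exists 1|exists 0 => s []].
set s0 := inf A.
have s00 : 0 <= s0 by apply: lb_le_inf; [exists 1|move=> s []].
have s01 : s0 <= 1 by apply: ge_inf => //; case: infA.
have d1 : 0 < enorm (x - y) + 1 by rewrite ltr_wpDl ?enorm_ge0.
have near (s r : R) : 0 < r -> `|s - s0| < r / (enorm (x - y) + 1) -> enorm (p s - p s0) < r.
  move=> r0; rewrite ltr_pdivlMr// pp enormZ; apply: le_lt_trans.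
  by rewrite ler_wpM2l// lerDl.
have Sp : S (p s0).
  apply: contrapT => nS.
  have : nbhs (p s0) (~` S) by apply: open_nbhs_nbhs; split=> //; exact: closed_openC.
  move=> /nbhs_enormP[r r0 hr].
  have rd : 0 < r / (enorm (x - y) + 1) by rewrite divr_gt0.
  have [s As sr] := inf_adherent rd infA.
  have s0s : s0 <= s by apply: ge_inf => //; case: infA.
  case: As => _; apply: hr; apply: near => //.
  by rewrite ger0_norm ?subr_ge0// ltrBlDl.
have s0p : 0 < s0.
  rewrite lt_neqAle s00 andbT; apply/eqP => s0E.
  by apply: nSy; move: Sp; rewrite /p -s0E scale0r addr0.
apply/ler_addgt0Pr => e e0.
have [r r0 hr] : exists2 r : R, 0 < r & forall z, enorm (z - p s0) < r -> m z < e.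
  by apply: uscm; rewrite mS.
have rd : 0 < r / (enorm (x - y) + 1) by rewrite divr_gt0.
pose s := Num.max 0 (s0 - r / (enorm (x - y) + 1) / 2).
have ss0 : s < s0 by rewrite gt_max s0p /=; lra.
have s0' : 0 <= s by rewrite le_max lexx.
have me : m (p s) < e.
  apply: hr; apply: near => //; rewrite distrC ger0_norm; last by lra.
  have : s0 - r / (enorm (x - y) + 1) / 2 <= s by rewrite le_max lexx orbT.
  lra.
have nSp : ~ S (p s).
  move=> Ss; have : s0 <= s by apply: ge_inf; [case: infA|split].
  by rewrite leNgt ss0.
have := le_trans (ler_norm _) (lip y (p s) nSy nSp).
have -> : enorm (y - p s) = s * enorm (x - y).
  by rewrite /p opprD addrA subrr add0r enormN enormZ ger0_norm.
have : s * enorm (x - y) <= enorm (x - y) by rewrite ler_piMl ?enorm_ge0//; lra.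
move=> /(ler_wpM2l L0); rewrite [enorm (y - x)]enormBC; lra.
Qed.

Lemma softmin_usc (T t : R) m : upper_semicontinuous m ->
  upper_semicontinuous (fun y => softmin T (m y - t)).
Proof.
move=> /uscP hm; apply/uscP => x al h.
pose e := (al - softmin T (m x - t)) / 2.
have e0 : 0 < e by rewrite divr_gt0// subr_gt0.
have [|r r0 hr] := hm x (m x + e); first by rewrite ltrDl.
exists r => // y /hr/ltW yx.
have : softmin T (m y - t) <= softmin T (m x - t + e) by apply: le_softmin; lra.
have := softmin_shift T (m x - t) (ltW e0); rewrite /e; lra.
Qed.

(** The competitor for [m2] is [m2] on [Z] and the maximum of [m2] and [t2 + u] off [Z].
    Semicontinuity across [Z] holds because [u <= 0] on [Z] and because a point of [Z] where
    [m2 < t2] is interior. *)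
Lemma front_step (cmin cmax L0 tau L C1 : R) c S1 S2 Z m1 m2 x0 (t1 t2 T : R) :
  0 < cmin -> 0 <= tau -> 1 <= L ->
  admissible_rate L cmax `|L0| C1 ->
  Omega cmin cmax L0 c -> arrival_time c S1 m1 -> arrival_time c S2 m2 ->
  closed Z -> S2 `<=` Z -> (forall x, ~ Z x -> t2 <= m2 x) ->
  (forall x, Z x -> t2 <= m2 x \/ nbhs x Z) ->
  0 <= t1 -> 0 <= t2 -> 1 <= T ->
  forall rho : R, expR (C1 * T) <= rho ->
  (forall x, Z x -> enorm (x - x0) < rho ->
     forall y, m1 y <= t1 + tau + L * enorm (y - x)) ->
  ~ Z x0 -> t1 + T < m1 x0 -> t2 + T - (tau + L + 2) <= m2 x0.
Proof.
move=> c0 tau0 L1 cst [cb cL] am1 am2 cZ S2Z nZ Znb t10 t20 T1 rho hrho hZ nZx0 m1x0.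
have [z0 [z00 z01 cA cB1 cB2]] := cst T rho T1 hrho.
have rho0 : 0 < rho by apply: lt_le_trans hrho; exact: expR_gt0.
have T0 : 0 < T by lra.
have T0' := ltW T0.
have d0 : 0 <= T^-1 by rewrite invr_ge0.
have k0 : 0 <= T / rho ^+ 2 by rewrite divr_ge0 ?sqr_ge0.
have L0' : 0 <= L by lra.
have n0 : 0 <= `|L0| := normr_ge0 _.
have mu0 : 0 <= 8 * `|L0| by rewrite mulr_ge0.
have a0 : 0 <= tau + L by lra.
have hc x : 0 <= c x <= cmax.
  by have /andP[h1 ->] := cb x; rewrite andbT; apply: le_trans h1; exact: ltW.
have hL x y : `|c x - c y| <= `|L0| * enorm (x - y).
  apply: le_trans (cL x y) _; rewrite ler_wpM2r ?enorm_ge0//; exact: ler_norm.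
have [[usc1 sv1 S1le] m1S _] := am1.
have [[usc2 sv2 S2le] m2S m2max] := am2.
pose M y := softmin T (m1 y - t1).
have Mlt y : M y < T := softmin_lt _ _.
have uscM : upper_semicontinuous M by exact: softmin_usc.
pose u := envelope (tau + L) T^-1 (T / rho ^+ 2) L (8 * `|L0|) x0 M.
have uscu : upper_semicontinuous u := envelope_usc a0 d0 k0 L1 mu0 T0' Mlt.
have uZ x : Z x -> u x <= 0.
  move=> Zx; apply: envelope_le0 => // y; rewrite /penalty !mulr0 add0r expR0 mul1r.
  have q0 : 0 <= (enorm (y - x) ^+ 2) ^+ 2 := sqr_ge0 _.
  (* Far from [x0] the cut-off alone exceeds [T]; nearby, [a = tau + L] and the quartic term cover
     [tau + L d], because [d <= 1 + d^4]. *)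
  have [far|close] := leP rho (enorm (x - x0)).
    have : T <= T / rho ^+ 2 * enorm (x - x0) ^+ 2.
      rewrite mulrAC ler_pdivlMr ?exprn_gt0// ler_pM2l//.
      by rewrite lerXn2r ?nnegrE ?enorm_ge0// ltW.
    have := mulr_ge0 L0' q0; have := Mlt y; lra.
  have h1 := hZ x Zx close y; have h2 : M y <= _ := softmin_le T (m1 y - t1).
  have h3 : enorm (y - x) <= 1 + (enorm (y - x) ^+ 2) ^+ 2.
    have := sqr_ge0 (enorm (y - x) ^+ 2 - 1 / 2); have := sqr_ge0 (enorm (y - x) - 1 / 2).
    lra.
  have := ler_wpM2l L0' h3.
  have : 0 <= T / rho ^+ 2 * enorm (x - x0) ^+ 2 by rewrite mulr_ge0 ?sqr_ge0.
  lra.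
pose U x := if pselect (Z x) then m2 x else Num.max (m2 x) (t2 + u x).
have UZ x : Z x -> U x = m2 x by move=> h; rewrite /U; case: pselect.
have UnZ x : ~ Z x -> U x = Num.max (m2 x) (t2 + u x).
  by move=> h; rewrite /U; case: pselect.
have m2U x : m2 x <= U x.
  by have [Zx|nZx] := pselect (Z x); [rewrite UZ|rewrite UnZ// le_max lexx].
have openZ x : ~ Z x -> exists2 r : R, 0 < r & forall y, enorm (y - x) < r -> ~ Z y.
  move=> h; have : nbhs x (~` Z) by apply: open_nbhs_nbhs; split=> //; exact: closed_openC.
  by move/nbhs_enormP.
have uscU : upper_semicontinuous U.
  apply/uscP => x al Ual.
  have [r r0 hr] := (uscP _).1 usc2 x al (le_lt_trans (m2U x) Ual).
  suff [r' r'0 hr'] : exists2 r' : R, 0 < r' & forall y, enorm (y - x) < r' ->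
      ~ Z y -> t2 + u y < al.
    exists (Num.min r r') => [|y]; first by rewrite lt_min r0.
    rewrite lt_min => /andP[yr yr'].
    have [Zy|nZy] := pselect (Z y); first by rewrite UZ// hr.
    by rewrite UnZ// gt_max hr//= hr'.
  have uscu' : u x < al - t2 ->
      exists2 r' : R, 0 < r' & forall y, enorm (y - x) < r' -> ~ Z y -> t2 + u y < al.
    by move=> /((uscP _).1 uscu)[r' r'0 hr']; exists r' => // y /hr' + _; lra.
  have [Zx|nZx] := pselect (Z x); last first.
    by apply: uscu'; move: Ual; rewrite UnZ// gt_max => /andP[_]; lra.
  rewrite UZ// in Ual.
  case: (Znb x Zx) => [t2m|/nbhs_enormP[r' r'0 hr']].
    by apply: uscu'; have := uZ x Zx; lra.
  by exists r' => // y /hr'.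
have subU : arrival_subsolution c S2 U.
  split=> // [phi x phi2 nS2 touch|x Sx]; last first.
    by rewrite UZ; [exact: S2le|exact: S2Z].
  have [r r0 hr] := (nbhs_enormP _ _).1 touch.
  have viam2 : U x = m2 x -> subsol_ineq c x (grad phi x) (hess phi x).
    move=> E; apply: sv2 => //; apply/nbhs_enormP; exists r => // y /hr.
    by rewrite E; have := m2U y; lra.
  have [Zx|nZx] := pselect (Z x); first by apply: viam2; exact: UZ.
  have [um|mu] := leP (t2 + u x) (m2 x).
    by apply: viam2; rewrite UnZ//; apply/max_idPl.
  have ux : 0 < u x by have := nZ x nZx; lra.
  apply: (envelope_subsol (t1 := t1) a0 L1 n0 T1 rho0 z00 z01 cA cB1 cB2 hc hL sv1
    uscM _ phi2 ux).
    by move=> y ty Sy; have := m1S y Sy; lra.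
  have [r' r'0 hr'] := openZ x nZx.
  apply/nbhs_enormP; exists (Num.min r r') => [|y]; first by rewrite lt_min r0.
  rewrite lt_min => /andP[/hr + /hr' nZy].
  rewrite (UnZ x)// (UnZ y)// (max_idPr (ltW mu)).
  have : t2 + u y <= Num.max (m2 y) (t2 + u y) by rewrite le_max lexx orbT.
  rewrite -/M -/u; lra.
have := m2max U subU x0; rewrite UnZ// ge_max => /andP[_ um2].
have Mx0 : T - 1 <= M x0 by apply: softmin_ge; lra.
have [small|big] := leP (tau + L) (M x0); last by have := nZ x0 nZx0; lra.
have h : 0 <= M x0 - (tau + L) by lra.
have := envelope_base a0 d0 k0 L1 mu0 T0' Mlt h; rewrite -/u => ub.
(* One unit is lost to the soft minimum and at most one to the factor [1 + 1/T]. *)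
suff : T - (tau + L) - 2 <= (M x0 - (tau + L)) / (1 + T^-1) by lra.
have iT : 0 < 1 + T^-1 by lra.
rewrite ler_pdivlMr//.
have TT : T * T^-1 = 1 by rewrite mulfV// gt_eqF.
have : 0 <= (tau + L) * T^-1 by rewrite mulr_ge0.
lra.
Qed.

End Comparison.

(** * Iteration over [n] fronts *)

Theorem proposition5p1 (R : realType) (C cmin tau L : R)
    (cmin_gt0 : 0 < cmin) (tau_ge1 : 1 <= tau) (L_ge1 : 1 <= L)
    (tauL : large_scale_lipschitz C cmin tau L) :
  exists2 C2 : R, 1 <= C2 &
  forall cmax L0 : R, cmin <= cmax ->
  exists2 C1 : R, 1 <= C1 &
  forall (c : 'rV[R]_2 -> R) (S1 S2 : set 'rV[R]_2) (m1 m2 : 'rV[R]_2 -> R)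
         (r s : R) (n : nat),
    Omega cmin cmax L0 c ->
    closed S1 -> closed S2 ->
    arrival_time c S1 m1 -> arrival_time c S2 m2 ->
    lipschitz_bound tau L S1 m1 -> lipschitz_bound tau L S2 m2 ->
    1 <= r -> subset_on (eball 0 r) S2 S1 ->
    1 <= s -> (0 < n)%N -> n%:R <= s -> Rbar C1 tau L s n <= r ->
    subset_on (eball 0 (r - Rbar C1 tau L s n))
      [set x | m2 x <= s - C2 * n%:R] [set x | m1 x <= s].
Proof.
have L0' : 0 <= L by lra.
have tau0 : 0 <= tau by lra.
(* One more than the loss in [front_step], so that each step ends in a strict contradiction. *)
exists (tau + L + 3) => [|cmax L0 cc]; first by lra.
have cm0 : 0 <= cmax by lra.
have [C1 C11 cst] := admissible_rate_exists L_ge1 cm0 (normr_ge0 L0).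
exists C1 => // c S1 S2 m1 m2 r s n Oc cS1 cS2 am1 am2 lip1 lip2 r1 S21 s1 n0 ns.
have np : 0 < n%:R :> R by rewrite ltr0n.
pose T := s / n%:R.
have sT : s = n%:R * T by rewrite /T mulrC divfK// gt_eqF.
have T1 : 1 <= T by rewrite /T ler_pdivlMr// mul1r.
pose rho := expR (C1 * (tau + L * T)).
have rhoE : Rbar C1 tau L s n = n%:R * rho by [].
rewrite rhoE => Rr x [/= m2x]; rewrite /eball /= subr0 => xr.
split=> /=; last exact: xr.
have hrho : expR (C1 * T) <= rho.
  rewrite ler_expR ler_wpM2l//; first by lra.
  have : T <= L * T by rewrite ler_peMl//; lra.
  lra.
pose t := T - (tau + L + 3).
have m2x' : m2 x <= n%:R * t by rewrite /t mulrBr -sT [n%:R * _]mulrC.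
(* If the loss exceeds the step length, the sublevel set of [m2] is empty because [m2] is
   nonnegative. *)
have [tneg|t0] := ltP t 0.
  have : n%:R * t < 0 by rewrite pmulr_rlt0.
  by have := arrival_time_ge0 x am2; lra.
have [[/uscP usc2 _ _] m2S _] := am2.
(* [m2] is only upper semicontinuous, so [front k] need not be closed; passing
   to its closure is harmless because [m1] is Lipschitz at unit scale. *)
pose front k := if k is 0%N then S2 else [set x | m2 x <= k%:R * t].
have claim k y : front k y -> enorm y < r - k%:R * rho -> m1 y <= k%:R * T.
  (* With [front 0] equal to [S2], the base case is the ordering of the sets itself. Each later step
     gives up a further [rho] of the radius. *)
  elim: k y => [|k IH] y.
    rewrite mulr0n !mul0r subr0 /= => Sy yr.
    have [Sy1 _] : (S1 `&` eball 0 r) y by apply: S21; split; rewrite /eball /= ?subr0.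
    by have [_ -> //] := am1.
  move=> /= m2y yr; rewrite leNgt; apply/negP => m1y.
  have rho0 : 0 < rho := expR_gt0 _.
  have kT0 : 0 <= k%:R * T by rewrite mulr_ge0//; lra.
  have kt0 : 0 <= k%:R * t by rewrite mulr_ge0.
  rewrite -natr1 mulrDl mul1r in m1y m2y yr.
  have S2f : S2 `<=` front k.
    by case: k {IH m1y m2y yr kT0} kt0 => [|k] kt0 z Sz //=; rewrite m2S.
  have nf z : ~ front k z -> k%:R * t <= m2 z.
    case: k {IH m1y m2y yr kT0 kt0 S2f} => [|k] /=.
      by rewrite mulr0n mul0r => _; exact: arrival_time_ge0 am2.
    by move=> /negP; rewrite -ltNge => /ltW.
  have fl z : m2 z < k%:R * t -> front k z.
    by apply: contraPP => /nf; rewrite leNgt => /negP.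
  have hZ z : closure (front k) z -> enorm (z - y) < rho ->
      forall w, m1 w <= k%:R * T + tau + L * enorm (w - z).
    move=> cz zy w; apply/ler_addgt0Pr => e e0.
    have zr : enorm z < r - k%:R * rho.
      by have := enormD (z - y) y; rewrite subrK; lra.
    have L1p : 0 < L + 1 by lra.
    pose d := Num.min (r - k%:R * rho - enorm z) (e / (L + 1)).
    have d0 : 0 < d by rewrite lt_min subr_gt0 zr divr_gt0.
    have [v [fv /= vz]] : front k `&` [set v | enorm (v - z) < d] !=set0.
      by apply: cz; apply/nbhs_enormP; exists d.
    rewrite lt_min ltr_pdivlMr// in vz; case/andP: vz => vz1 vz2.
    have vr : enorm v < r - k%:R * rho.
      by have := enormD (v - z) z; rewrite subrK; lra.
    have := lipschitz_bound_extend w tau0 L0' cS1 am1 lip1 kT0 (IH v fv vr).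
    have : enorm (w - v) <= enorm (w - z) + enorm (v - z).
      by rewrite -(subrKA z) [enorm (v - z)]enormBC; exact: enormD.
    move=> /(ler_wpM2l L0'); have := enorm_ge0 (v - z); lra.
  (* Otherwise [m1 y <= k T + tau], while [t >= 0] means [T >= tau + L + 3]. *)
  have nZy : ~ closure (front k) y.
    move=> /hZ; rewrite subrr enorm0 => /(_ rho0 y); rewrite subrr enorm0 mulr0.
    by move: t0; rewrite /t; lra.
  have := front_step (Z := closure (front k)) cmin_gt0 tau0 L_ge1 cst Oc am1 am2
    (@closed_closure _ _) _ _ _ kT0 kt0 T1 hrho hZ nZy m1y.
  move=> /(_ _ _ _)/wrap[].
  - by move=> z /S2f; exact: subset_closure.
  - by move=> z nz; apply: nf => fz; apply: nz; exact: subset_closure.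
  - move=> z _; have [|zt] := leP (k%:R * t) (m2 z); first by left.
    right; have [d d0 hd] := usc2 z _ zt; apply/nbhs_enormP; exists d => // v /hd/fl.
    exact: subset_closure.
  by move: m2y; rewrite /t; lra.
rewrite sT; apply: claim => //; case: (n) n0 m2x' => //.
Qed.
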